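(* Let $\Omega \subset \mathbf{R}^n$ be an open set, where $n \ge 2$ is an integer. If $u \in H_{0}^{1,(n,1)}(\Omega)$, then $u$ has a version $u^{*} \in C(\overline{\Omega}) \cap L^{\infty}(\Omega)$ and $$\|u\|_{L^{\infty}(\Omega)} \le \frac{1}{n \Omega_n^{1/n}} \|\nabla u\|_{L^{n,1}(\Omega; \mathbf{R}^n)}.$$ Moreover, if $\Omega \neq \mathbf{R}^n$, then $u^{*}=0$ on $\partial \Omega$.
   Context: $\Omega_n=|B(0,1)|$ is the Lebesgue measure of the unit ball of $\mathbf{R}^n$. Functions are real-valued unless stated otherwise. A version of $u$ is a function that agrees with $u$ almost everywhere in $\Omega$ (here $u^*$ denotes the version, not a rearrangement). Lorentz spaces. For measurable $f:\Omega\to\mathbf{R}$, let $\lambda_{[f]}(t)=|\{x\in\Omega:|f(x)|>t\}|$, $t\ge 0$; let $f^\sharp(t)=\inf\{v\ge 0:\lambda_{[f]}(v)\le t\}$ be the nonincreasing rearrangement of $f$ and $f^{\sharp\sharp}(t)=\frac1t\int_0^t f^\sharp(s)\,ds$. Define $\|f\|_{L^{n,1}(\Omega)}=\int_0^\infty t^{1/n}f^\sharp(t)\,\frac{dt}{t}$ and the equivalent norm $\|f\|_{L^{(n,1)}(\Omega)}=\int_0^\infty t^{1/n}f^{\sharp\sharp}(t)\,\frac{dt}{t}$. For vector-valued $f$, the norm of $f$ is the norm of the Euclidean length $|f|$. Sobolev-Lorentz spaces. $H^{1,(n,1)}(\Omega)$ is the completion of $\{\phi\in C^\infty(\Omega):\|\phi\|_{H^{1,(n,1)}(\Omega)}<\infty\}$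 with respect to the norm $\|\phi\|_{H^{1,(n,1)}(\Omega)}=\|\phi\|_{L^{(n,1)}(\Omega)}+\|\nabla\phi\|_{L^{(n,1)}(\Omega;\mathbf{R}^n)}$, and $H_0^{1,(n,1)}(\Omega)$ is the closure of $C_0^\infty(\Omega)$ in $H^{1,(n,1)}(\Omega)$. $\nabla u$ is the distributional gradient. *)

(* Defs.v *)
From HB Require Import structures.
From mathcomp Require Import all_boot all_order all_algebra.
From mathcomp Require Import all_classical all_reals all_analysis.
Set Implicit Arguments.
Unset Strict Implicit.
Unset Printing Implicit Defensive.
Import Order.TTheory GRing.Theory Num.Theory.
Import numFieldNormedType.Exports.
Local Open Scope classical_set_scope.
Local Open Scope ring_scope.

Section LebesgueRn.
Context {R : realType} {n : nat}.
Implicit Types (Q : 'rV[R]_n * 'rV[R]_n) (A : set 'rV[R]_n).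

Definition box Q : set 'rV[R]_n :=
  [set x | forall i, Q.1 0 i <= x 0 i <= Q.2 0 i].

(* The maximum is needed because [box Q] may be empty. *)
Definition box_volume Q : R := \prod_(i < n) Num.max 0 (Q.2 0 i - Q.1 0 i).

(* Covers are countable, possibly finite or empty, sets of boxes. *)
Definition lebesgue_outer A : \bar R :=
  ereal_inf [set \esum_(Q in C) (box_volume Q)%:E |
    C in [set C | countable C /\ A `<=` \bigcup_(Q in C) box Q]].

Lemma box_volume_ge0 Q : 0 <= box_volume Q.
Proof. by apply: prodr_ge0 => i _; rewrite le_max lexx. Qed.

Let lebesgue_outer0 : lebesgue_outer set0 = 0%E.
Proof.
apply/eqP; rewrite eq_le; apply/andP; split.
  by apply: ereal_inf_lbound; exists set0; rewrite ?esum_set0//; split.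
apply: le_ereal_inf_tmp => _ [C _ <-]; apply: esum_ge0 => Q _.
by rewrite lee_fin box_volume_ge0.
Qed.

Let lebesgue_outer_ge0 A : (0 <= lebesgue_outer A)%E.
Proof.
apply: le_ereal_inf_tmp => _ [C _ <-]; apply: esum_ge0 => Q _.
by rewrite lee_fin box_volume_ge0.
Qed.

Let le_lebesgue_outer : {homo lebesgue_outer : A B / A `<=` B >-> (A <= B)%E}.
Proof.
move=> A B AB; apply: ereal_inf_le_tmp => _ [C [cC BC] <-].
by exists C => //; split => //; exact: subset_trans BC.
Qed.

Let lebesgue_outer_sigma_subadditive : sigma_subadditive lebesgue_outer.
Proof.
move=> A.
have [[i ioo]|] := pselect (exists i, lebesgue_outer (A i) = +oo%E).
  by rewrite (eseries_pinfty _ _ ioo) ?leey// => k _; rewrite -ltNye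
    (lt_le_trans _ (lebesgue_outer_ge0 _)).
rewrite -forallNE => Aoo.
apply/lee_addgt0Pr => e e0.
rewrite (le_trans _ (epsilon_trick _ _ (ltW e0)))//.
pose P k (C : set ('rV[R]_n * 'rV[R]_n)) :=
  [/\ countable C, A k `<=` \bigcup_(Q in C) box Q &
     (\esum_(Q in C) (box_volume Q)%:E <=
       lebesgue_outer (A k) + (e / (2 ^ k.+1)%:R)%:E)%E].
have [C PC] : {C : nat -> set ('rV[R]_n * 'rV[R]_n) & forall k, P k (C k)}.
  apply: (@choice _ _ P) => k.
  have fA : lebesgue_outer (A k) \is a fin_num.
    by rewrite ge0_fin_numE// ltey; apply/eqP.
  have ek : 0 < e / (2 ^ k.+1)%:R by rewrite divr_gt0// ltr0n expn_gt0.
  have [_ [C [cC AC] <-] /ltW lt] := lb_ereal_inf_adherent ek fA.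
  by exists C.
apply: (@le_trans _ _ (\esum_(Q in \bigcup_k C k) (box_volume Q)%:E)).
  apply: ereal_inf_lbound; exists (\bigcup_k C k) => //; split.
    by apply: bigcup_countable => // k _; have [] := PC k.
  move=> x [k _ Akx]; have [_ /(_ x Akx) [Q CQ Qx] _] := PC k.
  by exists Q => //; exists k.
rewrite seqDU_bigcup_eq esum_bigcupT; last 2 first.
- exact: trivIset_seqDU.
- by move=> Q; rewrite lee_fin box_volume_ge0.
rewrite -nneseries_esumT; last first.
  by move=> k; apply: esum_ge0 => Q _; rewrite lee_fin box_volume_ge0.
apply: lee_nneseries => [k _ _|k _].
  by apply: esum_ge0 => Q _; rewrite lee_fin box_volume_ge0.
have [_ _] := PC k; apply: le_trans.
rewrite esum_mkcond [leRHS]esum_mkcond; apply: le_esum => Q _.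
case: ifPn => [|_].
  by rewrite inE => -[CkQ _]; rewrite mem_set.
by case: ifPn => // _; rewrite lee_fin box_volume_ge0.
Qed.

HB.instance Definition _ := isOuterMeasure.Build R 'rV[R]_n lebesgue_outer
  lebesgue_outer0 lebesgue_outer_ge0 le_lebesgue_outer
  lebesgue_outer_sigma_subadditive.

End LebesgueRn.

(* 'rV[R]_n with the sigma-algebra of Lebesgue-measurable sets. *)
Definition Rn (R : realType) (n : nat) : measurableType _ :=
  caratheodory_type (@lebesgue_outer R n : {outer_measure set _ -> \bar R}).

Definition leb (R : realType) (n : nat) : set (Rn R n) -> \bar R :=
  @lebesgue_outer R n.

HB.instance Definition _ (R : realType) (n : nat) := Measure.copy (@leb R n)
  ((@lebesgue_outer R n : {outer_measure set _ -> \bar R}) :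
   set (caratheodory_type _) -> \bar R).
Arguments leb {R n}.

(* The norm of 'rV[R]_n in the library is the sup norm. *)
Definition eucl {R : realType} {n : nat} (v : 'rV[R]_n) : R :=
  Num.sqrt (\sum_(i < n) v 0 i ^+ 2).

Definition unit_ball_volume (R : realType) (n : nat) : R :=
  fine (leb [set x : Rn R n | eucl x < 1]).

Section Lorentz.
Context {R : realType} {n : nat} (Omega : set 'rV[R]_n).
Implicit Types f : 'rV[R]_n -> R.
Local Open Scope ereal_scope.

Definition distribution_fun f (t : R) : \bar R :=
  leb (Omega `&` [set x | (t < `|f x|)%R] : set (Rn R n)).

Definition rearr f (t : R) : \bar R :=
  ereal_inf [set v%:E | v in [set v | (0 <= v)%R /\
                                      distribution_fun f v <= t%:E]].

Definition rearr_avg f (t : R) : \bar R :=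
  t^-1%:E * \int[lebesgue_measure]_(s in `]0%R, t[) rearr f s.

(* The L^{n,1} norm; n is also the dimension. *)
Definition lorentz f : \bar R :=
  \int[lebesgue_measure]_(t in `]0%R, +oo[)
    ((t `^ n%:R^-1 / t)%:E * rearr f t).

(* The L^{(n,1)} norm. *)
Definition lorentz_avg f : \bar R :=
  \int[lebesgue_measure]_(t in `]0%R, +oo[)
    ((t `^ n%:R^-1 / t)%:E * rearr_avg f t).

(* Extension by 0 makes this the essential supremum of |f| over Omega. *)
Definition Linfty f : \bar R :=
  'N[@leb R n]_+oo [EFin \o (f \_ Omega)].

End Lorentz.

Section Sobolev.
Context {R : realType} {n : nat}.
Implicit Types (Omega : set 'rV[R]_n) (f phi u : 'rV[R]_n -> R)
  (Du : 'rV[R]_n -> 'rV[R]_n).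

Definition partial (i : 'I_n) f : 'rV[R]_n -> R :=
  fun x => 'D_(delta_mx 0 i) f x.

Definition partials (s : seq 'I_n) f : 'rV[R]_n -> R := foldr partial f s.

Definition grad f : 'rV[R]_n -> 'rV[R]_n := fun x => \row_i partial i f x.

(* For Omega open; the values of f outside Omega are irrelevant. *)
Definition smooth_on Omega f : Prop :=
  forall s x, Omega x ->
    {for x, continuous (partials s f)} /\
    forall i, derivable (partials s f) x (delta_mx 0 i).

(* C_0^oo(Omega), its elements being extended by 0 to the whole space. *)
Definition test_function Omega phi : Prop :=
  [/\ smooth_on setT phi,
      compact (closure [set x | phi x != 0]) &
      closure [set x | phi x != 0] `<=` Omega].

Definition locally_integrable_on Omega f : Prop :=
  measurable_fun (Omega : set (Rn R n)) (f : Rn R n -> R) /\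
  forall K : set 'rV[R]_n, compact K -> K `<=` Omega ->
    leb.-integrable (K : set (Rn R n)) (EFin \o f).

Definition distributional_grad Omega u Du : Prop :=
  [/\ locally_integrable_on Omega u,
      forall i, locally_integrable_on Omega (fun x => Du x 0 i) &
      forall phi i, test_function Omega phi ->
        (\int[leb]_(x in (Omega : set (Rn R n))) (u x * partial i phi x)%:E =
         - \int[leb]_(x in (Omega : set (Rn R n))) (Du x 0 i * phi x)%:E)%E].

Definition sl_norm Omega u Du : \bar R :=
  (lorentz_avg Omega u + lorentz_avg Omega (eucl \o Du))%E.

Definition sl_cvg Omega (phi : nat -> 'rV[R]_n -> R) u Du : Prop :=
  sl_norm Omega (u \- phi k)%R (Du \- grad (phi k))%R @[k --> \oo] --> 0%E.

(* H^{1,(n,1)}(Omega). The completion for the graph norm is the set of limits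
   (u, Du) of pairs (phi, grad phi); the gradient Du, which u determines up to
   a null set, is therefore kept as an argument. *)
Definition sobolev_lorentz Omega u Du : Prop :=
  distributional_grad Omega u Du /\
  exists phi : nat -> 'rV[R]_n -> R,
    (forall k, smooth_on Omega (phi k) /\
               (sl_norm Omega (phi k) (grad (phi k)) < +oo)%E) /\
    sl_cvg Omega phi u Du.

Definition sobolev_lorentz0 Omega u Du : Prop :=
  sobolev_lorentz Omega u Du /\
  exists phi : nat -> 'rV[R]_n -> R,
    (forall k, test_function Omega (phi k)) /\ sl_cvg Omega phi u Du.

End Sobolev.

(* Main.v *)
(* The test functions satisfy the sharp bound pointwise, which is then passed to
   the limit. Let [f = |grad phi|], let [B] be the unit ball and [c] the integral
   of [1/|y|] over [B], finite because [n >= 2]. The fundamental theorem of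
   calculus along a ray gives [|phi x| / |y| <= int_0^oo f(x + r y) dr]. Cutting
   [f] into layers [d * 1_{f > k d}] and integrating over [y] in [B], the layer of
   level [s] contributes the measure of the cone
   [{(y, r) | y in B, r > 0, x + r y in {f > s}}]. Among sets [{f > s}] of given
   measure this is largest for a ball centred at [x], of radius [rho s] say, where
   it equals [c * rho s]. The constant [c] cancels, leaving
   [|phi x| <= sum_k d * rho(k d)] with [rho s = (|{f > s}| / |B|)^(1/n)], and
   [n * sum_(k >= 1) d * |{f > k d}|^(1/n)] is at most the [L^{n,1}] norm of [f]. *)

Require Import Defs.
From HB Require Import structures.
From mathcomp Require Import all_boot all_order all_algebra.
From mathcomp Require Import all_classical all_reals all_analysis.
From mathcomp Require Import measurable_realfun.
From mathcomp Require Import ring lra.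
Import Order.TTheory GRing.Theory Num.Theory.
Import numFieldNormedType.Exports.
Local Open Scope classical_set_scope.
Local Open Scope ring_scope.

(** * Lebesgue measure on R^n *)

(** The average runs over a ball of velocities [y], not over a sphere of directions: the cone is
    then a subset of R^n x R whose measure Tonelli gives in either order. Slices at fixed [y]
    produce the integral of [1/|y|]; slices at fixed [r] are compared with those of a ball by the
    scaling of Lebesgue measure alone. Neither polar coordinates nor a rearrangement inequality
    enters, and the constant stays sharp. Measurability shapes the rest. The sigma-algebra of the
    product is generated by rectangles, so the sets measured there are kept open; hence the ray
    argument is run for C^1 functions of compact support, whose sets [{|grad phi| > s}] are open of
    finite measure. [Du] enters through distribution functions, handled by monotonicity and
    subadditivity of the outer measure. The layers are finitely many. They are counted from level 0
    in the upper bound and from level [d] in the lower one; the difference [d * rho 0] vanishes with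
    [d]. Test functions are extended by 0, so they converge uniformly on all of R^n, and their limit
    is continuous and vanishes off [Omega]. *)

Lemma esum_image_le (R : realType) (S T : choiceType) (J : set S) (e : S -> T)
    (a : T -> \bar R) : (forall t, 0 <= a t)%E ->
  (\esum_(t in e @` J) a t <= \esum_(j in J) a (e j))%E.
Proof.
move=> a0; have [->|/set0P[j0 Jj0]] := eqVneq J set0; first by rewrite image_set0 !esum_set0.
(* A section [g] of [e] over the image turns the sum over the image into a sum over part of [J]. *)
have [g gP] : {g : T -> S & forall t, (e @` J) t -> J (g t) /\ e (g t) = t}.
  apply: (@choice _ _ (fun t j => (e @` J) t -> J j /\ e j = t)) => t.
  have [[j Jj <-]|nt] := pselect ((e @` J) t); first by exists j.
  by exists j0.
have -> : \esum_(t in e @` J) a t = \esum_(t in e @` J) (a \o e) (g t).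
  by apply: eq_esum => t /gP[_ /= ->].
rewrite -(@esum_image _ _ _ (e @` J) g (a \o e)); last first.
  move=> x y; rewrite !inE => /gP[_ ex] /gP[_ ey] gxy.
  by rewrite -ex -ey gxy.
rewrite esum_mkcond [leRHS]esum_mkcond; apply: le_esum => j _.
case: ifPn => [|_]; last by case: ifPn => // _; exact: a0.
by rewrite inE => -[t /gP[Jt _] <-]; rewrite mem_set.
Qed.

Lemma esumZl_le (R : realType) (T : choiceType) (J : set T) (k : R)
    (a : T -> \bar R) : 0 <= k -> (forall t, 0 <= a t)%E ->
  (\esum_(t in J) (k%:E * a t) <= k%:E * \esum_(t in J) a t)%E.
Proof.
move=> k0 a0; apply: ge_ereal_sup => _ [X [finX XJ] <-].
rewrite -ge0_mule_fsumr//; apply: lee_wpmul2l; first by rewrite lee_fin.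
by apply: esum_ge; exists X.
Qed.

Section lebesgue_Rn.
Context {R : realType} {n : nat}.
Implicit Types (Q : 'rV[R]_n * 'rV[R]_n) (A : set 'rV[R]_n).
Local Open Scope ereal_scope.

(** The map [f] may send distinct boxes of [J] to the same box, for instance when it cuts them; the
    sum over the image cover can then only be smaller. *)
Lemma lebesgue_outer_cover (J : set ('rV[R]_n * 'rV[R]_n)) f A :
  countable J -> A `<=` \bigcup_(Q in J) box (f Q) ->
  lebesgue_outer A <= \esum_(Q in J) (box_volume (f Q))%:E.
Proof.
move=> cJ AJ; apply: le_trans (@esum_image_le _ _ _ J f
    (fun Q => (box_volume Q)%:E) _); last first.
  by move=> t; rewrite lee_fin box_volume_ge0.
apply: ereal_inf_lbound; exists (f @` J) => //; split.
  exact: sub_countable (card_image_le _ _) cJ.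
by move=> x /AJ[Q JQ xQ]; exists (f Q) => //; exists Q.
Qed.

Lemma lebesgue_outer_box_le Q : lebesgue_outer (box Q) <= (box_volume Q)%:E.
Proof.
rewrite -(@esum_set1 _ _ Q (fun Q => (box_volume Q)%:E)) ?lee_fin ?box_volume_ge0//.
apply: ereal_inf_lbound; exists [set Q] => //; split; first exact: finite_set_countable.
by move=> x ?; exists Q.
Qed.

Let upd (v : 'rV[R]_n) i c : 'rV[R]_n := \row_j if j == i then c else v 0%R j.

(** The hyperplane [x i = c] cuts [Q] into two boxes. Negative edge lengths count as 0, so the
    identity also covers a box that is empty or lies on one side. *)
Let halfspaces_volume Q i c :
  (box_volume (Q.1, upd Q.2 i (Num.min (Q.2 0%R i) c)) +
   box_volume (upd Q.1 i (Num.max (Q.1 0%R i) c), Q.2) = box_volume Q)%R.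
Proof.
rewrite /box_volume (bigD1 i)//= [X in (_ + X)%R](bigD1 i)//= [RHS](bigD1 i)//=.
set p := (\prod_(j < n | j != i) Num.max 0 (Q.2 0%R j - Q.1 0%R j))%R.
have -> : (\prod_(j < n | j != i) Num.max 0
  (upd Q.2 i (Num.min (Q.2 0%R i) c) 0%R j - Q.1 0%R j) = p)%R.
  by apply: eq_bigr => j /negPf ji; rewrite mxE ji.
have -> : (\prod_(j < n | j != i) Num.max 0
  (Q.2 0%R j - upd Q.1 i (Num.max (Q.1 0%R i) c) 0%R j) = p)%R.
  by apply: eq_bigr => j /negPf ji; rewrite mxE ji.
rewrite !mxE eqxx -mulrDl; congr (_ * p)%R.
rewrite /Num.max /Num.min.
by case: (ltP (Q.2 0%R i) c) => ?; case: (ltP (Q.1 0%R i) c) => ?;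
  repeat (case: ltP => ?); lra.
Qed.

(** Cutting each box of a cover of [X] along the hyperplane gives covers of the two parts of [X]
    with the same total volume, which is Caratheodory's criterion. *)
Lemma measurable_halfspace (i : 'I_n) (c : R) :
  measurable ([set x | x 0 i <= c]%R : set (Rn R n)).
Proof.
apply: le_caratheodory_measurable => X; set H := (X in X `&` _).
apply: le_ereal_inf_tmp => _ [C [cC XC] <-].
under eq_esum do rewrite -(halfspaces_volume _ i c) EFinD.
rewrite esumD; last 2 first.
- by move=> *; rewrite lee_fin box_volume_ge0.
- by move=> *; rewrite lee_fin box_volume_ge0.
apply: leeD.
  apply: (@lebesgue_outer_cover _
    (fun Q => (Q.1, upd Q.2 i (Num.min (Q.2 0%R i) c)))) => // x [xX xc].
  have [Q CQ Qx] := XC _ xX; exists Q => // j /=; rewrite mxE.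
  by case: eqP => [->|_]; rewrite ?le_min ?xc ?Qx//= andbT; exact: Qx.
apply: (@lebesgue_outer_cover _
  (fun Q => (upd Q.1 i (Num.max (Q.1 0%R i) c), Q.2))) => // x [xX xc].
have [Q CQ Qx] := XC _ xX; exists Q => // j /=; rewrite mxE.
have {}xc : (c <= x 0 i)%R by apply/ltW; rewrite ltNge; exact/negP.
by case: eqP => [->|_]; rewrite ?ge_max ?xc ?Qx//= andbT; case/andP: (Qx i) => ->.
Qed.

End lebesgue_Rn.

Section lebesgue_Rn_affine.
Context {R : realType} {n : nat}.
Implicit Types (A : set 'rV[R]_n) (r : R) (a : 'rV[R]_n).
Local Open Scope ereal_scope.

Let box_volume_affine (Q : 'rV[R]_n * 'rV[R]_n) r a : (0 < r)%R ->
  box_volume (r^-1 *: (Q.1 - a), r^-1 *: (Q.2 - a)) = (r ^- n * box_volume Q)%R.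
Proof.
move=> r0; rewrite /box_volume /=.
have -> : (r ^- n = \prod_(i < n) r^-1)%R by rewrite prodr_const card_ord exprVn.
rewrite -big_split/=; apply: eq_bigr => i _.
rewrite !mxE -mulrBr maxr_pMr ?invr_ge0 ?(ltW r0)// mulr0.
by congr (Num.max _ (_ * _)%R); lra.
Qed.

Let lebesgue_outer_affine_le A r a : (0 < r)%R ->
  lebesgue_outer [set y | A (a + r *: y)%R] <= (r ^- n)%:E * lebesgue_outer A.
Proof.
move=> r0; have rn0 : (0 < r ^- n)%R by rewrite invr_gt0 exprn_gt0.
rewrite -lee_pdivrMl//.
apply: le_ereal_inf_tmp => _ [C [cC AC] <-].
rewrite lee_pdivrMl//.
apply: (@le_trans _ _ (\esum_(Q in C) ((r ^- n)%:E * (box_volume Q)%:E))); last first.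
  by apply: esumZl_le => [|Q]; rewrite ?invr_ge0 ?exprn_ge0 ?lee_fin ?box_volume_ge0// ltW.
under eq_esum => Q _ do rewrite -EFinM -(box_volume_affine _ _ a r0).
apply: (@lebesgue_outer_cover _ _ C
  (fun Q => (r^-1 *: (Q.1 - a), r^-1 *: (Q.2 - a))%R)) => // y /AC[Q CQ Qy].
exists Q => // i; have := Qy i; rewrite !mxE/= => /andP[h1 h2].
by rewrite !(mulrC r^-1)%R ler_pdivrMr// ler_pdivlMr//; apply/andP; split; lra.
Qed.

(** The missing inequality is the one already proved, applied to the inverse affine map. *)
Lemma lebesgue_outer_affine A r a : (0 < r)%R ->
  lebesgue_outer [set y | A (a + r *: y)%R] = (r ^- n)%:E * lebesgue_outer A.
Proof.
move=> r0; apply/eqP; rewrite eq_le lebesgue_outer_affine_le//=.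
have rn0 : (0 < r ^- n)%R by rewrite invr_gt0 exprn_gt0.
rewrite -lee_pdivlMl//.
set P := [set y | _].
have -> : A = [set z | P (- (r^-1 *: a) + r^-1 *: z)%R].
  apply/seteqP; split=> z; rewrite /P/= scalerDr scalerN !scalerA divff ?gt_eqF//.
    by rewrite !scale1r addrA subrr add0r.
  by rewrite !scale1r addrA subrr add0r.
have rV0 : (0 < r^-1)%R by rewrite invr_gt0.
by apply: le_trans (lebesgue_outer_affine_le _ _ _ rV0) _; rewrite exprVn.
Qed.

End lebesgue_Rn_affine.

Section lebesgue_box.
Context {R : realType}.
Local Notation mu := (@lebesgue_measure R).

(** Induction on the dimension by slicing. Fixing the last coordinate [t] turns the [k]-th box into
    a box of lower dimension that counts only when [t] lies in its last edge; this is why weights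
    [w] are carried along. Integrating over [t] by monotone convergence then replaces a compactness
    argument. Points are sequences, so that lowering the dimension needs no change of type. *)
Let box_cover_volume n : forall (a b : nat -> R) (w : nat -> R) (p q : nat -> nat -> R),
  (forall k, 0 <= w k) ->
  (forall x : nat -> R, (forall i, (i < n)%N -> a i <= x i <= b i) ->
    (1 <= \sum_(k <oo) (w k * \prod_(i < n) \1_(`[p k i, q k i]) (x i))%:E)%E) ->
  ((\prod_(i < n) Num.max 0 (b i - a i))%:E <=
    \sum_(k <oo) (w k * \prod_(i < n) Num.max 0 (q k i - p k i))%:E)%E.
Proof.
elim: n => [|n IH] a b w p q w0 H.
  rewrite big_ord0; apply: le_trans (H a _) _ => //.
  by rewrite le_eqVlt; apply/orP; left; apply/eqP/eq_eseriesr => k _; rewrite !big_ord0.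
rewrite big_ord_recr/=.
set B := \prod_(i < n) Num.max 0 (b i - a i).
have B0 : 0 <= B by apply: prodr_ge0 => i _; rewrite le_max lexx.
have [ab|ab] := ltP (b n) (a n).
  rewrite (@max_l _ _ 0 (b n - a n)) ?mulr0; last by lra.
  apply: nneseries_ge0 => k _ _; rewrite lee_fin mulr_ge0//.
  by apply: prodr_ge0 => i _; rewrite le_max lexx.
pose V k := \prod_(i < n) Num.max 0 (q k i - p k i).
have V0 k : 0 <= V k by apply: prodr_ge0 => i _; rewrite le_max lexx.
have IHt t : t \in `[a n, b n] ->
    (B%:E <= \sum_(k <oo) (w k * V k * \1_(`[p k n, q k n]) t)%:E)%E.
  rewrite in_itv/= => tab.
  apply: le_trans (IH a b (fun k => w k * \1_(`[p k n, q k n]) t) p q _ _) _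
    => [k|x xab|]; first by rewrite mulr_ge0.
  - apply: le_trans (H (fun i => if i == n then t else x i) _) _ => [i|].
      by rewrite ltnS leq_eqVlt; case: eqP => [->//|_ /=]; exact: xab.
    rewrite le_eqVlt; apply/orP; left; apply/eqP/eq_eseriesr => k _; congr (_%:E).
    rewrite big_ord_recr/= eqxx [X in w k * X]mulrC mulrA; congr (_ * _).
    by apply: eq_bigr => i _; rewrite (ltn_eqF (ltn_ord i)).
  - rewrite le_eqVlt; apply/orP; left; apply/eqP/eq_eseriesr => k _; congr (_%:E).
    by rewrite mulrAC.
have mu_int : (\int[mu]_(t in `[a n, b n]) B%:E = (B * (b n - a n))%:E)%E.
  rewrite integral_cst//= lebesgue_measure_itv/= lte_fin.
  by rewrite lt_neqAle ab andbT; case: eqP => [->|_] /=; rewrite ?subrr ?mulr0 ?mule0.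
rewrite max_r ?subr_ge0// -mu_int.
apply: (@le_trans _ _ (\int[mu]_(t in `[a n, b n])
   (\sum_(k <oo) (w k * V k * \1_(`[p k n, q k n]) t)%:E))%E).
  apply: ge0_le_integral => //=.
  apply: (@ge0_emeasurable_sum _ _ _ _
      (fun k t => (w k * V k * \1_(`[p k n, q k n]) t)%:E) xpredT) => [k x _ _|k _].
    by rewrite lee_fin mulr_ge0 ?mulr_ge0.
  by apply/measurable_EFinP; apply: measurable_funM => //; exact: measurable_indic.
rewrite integral_nneseries//; last 2 first.
- move=> k; apply/measurable_EFinP; exact: measurable_funM.
- by move=> k x _; rewrite lee_fin mulr_ge0 ?mulr_ge0.
apply: lee_nneseries => [k _ _|k _].
  by apply: integral_ge0 => x _; rewrite lee_fin mulr_ge0 ?mulr_ge0.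
under eq_integral do rewrite EFinM.
rewrite ge0_integralZl_EFin//; [|exact/measurable_EFinP|exact: mulr_ge0].
rewrite integral_indic//= big_ord_recr/= mulrA [leRHS]EFinM.
apply: lee_wpmul2l; first by rewrite lee_fin mulr_ge0.
apply: (@le_trans _ _ (mu `[p k n, q k n]%classic)).
  by apply: le_measure; rewrite ?inE//; exact: measurableI.
rewrite lebesgue_measure_itv/= lte_fin.
by case: ifPn => _; rewrite -?EFinB lee_fin le_max lexx ?orbT.
Qed.

Lemma lebesgue_outer_box n (Q : 'rV[R]_n * 'rV[R]_n) :
  lebesgue_outer (box Q) = (box_volume Q)%:E.
Proof.
apply/eqP; rewrite eq_le lebesgue_outer_box_le/=.
apply: le_ereal_inf_tmp => _ [C [cC QC] <-].
case: n Q C cC QC => [|n] Q C cC QC.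
  (* Coordinates are read below through [inord], which needs ['I_n] nonempty. In dimension 0 every
     box has volume 1, an empty product, and one box suffices. *)
  have [P CP _] : exists2 P, C P & box P 0 by apply: QC => -[].
  apply: esum_ge; exists [set P] => //; first by split=> // _ ->.
  by rewrite fsbig_set1 /box_volume !big_ord0.
have /countable_injP[f finj] := cC.
pose g k := xget (0, 0) [set P | C P /\ f P = k].
have gf P : C P -> g (f P) = P.
  move=> CP; rewrite /g; case: xgetP => [P' _ [CP' e]|/(_ P)/= []//].
  by apply: finj; rewrite ?inE.
have -> : (\esum_(P in C) (box_volume P)%:E =
    \esum_(P in C) (box_volume (g (f P)))%:E)%E.
  by apply: eq_esum => P CP; rewrite gf.
rewrite -(@esum_image _ _ _ C f (fun k => (box_volume (g k))%:E))//.
rewrite esum_mkcond -nneseries_esumT; last first.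
  by move=> k; case: ifP => // _; rewrite lee_fin box_volume_ge0.
(* Indices outside the image of [f] get weight 0, which makes the default value of [g] there
   harmless. *)
pose w k : R := if k \in f @` C then 1 else 0.
pose i0 (v : 'rV[R]_n.+1) (i : nat) : R := v 0 (inord i).
have volE P : box_volume P = \prod_(i < n.+1) Num.max 0 (i0 P.2 i - i0 P.1 i).
  by apply: eq_bigr => i _; rewrite /i0 inord_val.
under eq_eseriesr => k _.
  rewrite (_ : (if _ then _ else _) = (w k * box_volume (g k))%:E); last first.
    by rewrite /w; case: ifP; rewrite ?mul1r ?mul0r.
  rewrite volE.
  over.
rewrite volE; apply: (@box_cover_volume n.+1 (i0 Q.1) (i0 Q.2) w
  (fun k => i0 (g k).1) (fun k => i0 (g k).2)) => [k|x xQ].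
  by rewrite /w; case: ifP.
have [P CP Px] : exists2 P, C P & box P (\row_(i < n.+1) x i).
  by apply: QC => i; rewrite mxE; have := xQ i (ltn_ord i); rewrite /i0 inord_val.
apply: le_trans (@nneseries_lim_ge _ _ xpredT 0%N (f P).+1 _); last first.
  move=> k _ _; rewrite lee_fin mulr_ge0//; first by rewrite /w; case: ifP.
  exact: prodr_ge0.
rewrite big_nat_recr//= gf// {2}/w mem_set; last by exists P.
rewrite mul1r [X in (_ + X%:E)%E]big1; last first.
  move=> i _; rewrite indicE mem_set//= in_itv/=.
  by have := Px i; rewrite mxE /i0 inord_val.
rewrite leeDr//; apply: sume_ge0 => k _; rewrite lee_fin mulr_ge0//.
  by rewrite /w; case: ifP.
exact: prodr_ge0.
Qed.

End lebesgue_box.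

(** * The Euclidean norm of row vectors *)

Section eucl_norm.
Context {R : realType} {n : nat}.
Implicit Types v w : 'rV[R]_n.

Lemma eucl_ge0 v : 0 <= eucl v.
Proof. exact: sqrtr_ge0. Qed.

Lemma eucl_sqr v : eucl v ^+ 2 = \sum_(i < n) v 0 i ^+ 2.
Proof. by rewrite sqr_sqrtr// sumr_ge0// => i _; exact: sqr_ge0. Qed.

Lemma coord_le_eucl v i : `|v 0 i| <= eucl v.
Proof.
rewrite -(@ler_pXn2r _ 2%N) ?nnegrE ?eucl_ge0// eucl_sqr real_normK ?num_real//.
by rewrite (bigD1 i)//= lerDl sumr_ge0// => j _; exact: sqr_ge0.
Qed.

Lemma eucl_le_sum v : eucl v <= \sum_(i < n) `|v 0 i|.
Proof.
have s0 : 0 <= \sum_(i < n) `|v 0 i| by exact: sumr_ge0.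
rewrite -(@ler_pXn2r _ 2%N) ?nnegrE ?eucl_ge0// eucl_sqr.
suff h : forall m (a : 'I_m -> R), (\sum_(i < m) a i ^+ 2 <= (\sum_(i < m) `|a i|) ^+ 2) /\
    0 <= \sum_(i < m) `|a i|.
  exact: (h n (fun i => v 0 i)).1.
elim=> [|m IH] a; first by rewrite !big_ord0 expr0n lexx.
have [h1 h2] := IH (fun i => a (lift ord0 i)).
rewrite !big_ord_recl; split; last by rewrite addr_ge0.
rewrite sqrrD real_normK ?num_real// -addrA lerD2l.
by rewrite (le_trans h1)// lerDr mulrn_wge0// mulr_ge0.
Qed.

Lemma euclZ (a : R) v : eucl (a *: v) = `|a| * eucl v.
Proof.
rewrite /eucl -sqrtr_sqr -sqrtrM ?sqr_ge0// mulr_sumr.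
by congr Num.sqrt; apply: eq_bigr => i _; rewrite mxE exprMn.
Qed.

Lemma eucl0 : eucl (0 : 'rV[R]_n) = 0.
Proof. by rewrite -(scale0r (0 : 'rV[R]_n)) euclZ normr0 mul0r. Qed.

Lemma euclN v : eucl (- v) = eucl v.
Proof. by rewrite -scaleN1r euclZ normrN1 mul1r. Qed.

Lemma eucl_gt0 v : (0 < eucl v) = (v != 0).
Proof.
rewrite lt_neqAle eucl_ge0 andbT eq_sym; congr (~~ _).
apply/eqP/eqP => [v0|->]; last exact: eucl0.
apply/rowP => i; rewrite mxE; apply/eqP; rewrite -normr_le0.
by rewrite (le_trans (coord_le_eucl _ _))// v0.
Qed.

Lemma eucl_cauchy_schwarz v w : `|\sum_(i < n) v 0 i * w 0 i| <= eucl v * eucl w.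
Proof.
rewrite -(@ler_pXn2r _ 2%N) ?nnegrE ?mulr_ge0 ?eucl_ge0// exprMn !eucl_sqr.
rewrite real_normK ?num_real//.
set A := \sum_(i < n) v 0 i ^+ 2; set B := \sum_(i < n) w 0 i ^+ 2.
set C := \sum_(i < n) v 0 i * w 0 i.
have A0 : 0 <= A by apply: sumr_ge0 => i _; exact: sqr_ge0.
(* The vector [A w - C v] is [A] times the component of [w] orthogonal to [v]. *)
have : 0 <= \sum_(i < n) (A * w 0 i - C * v 0 i) ^+ 2.
  by apply: sumr_ge0 => i _; exact: sqr_ge0.
have -> : \sum_(i < n) (A * w 0 i - C * v 0 i) ^+ 2 = A * (A * B - C ^+ 2).
  transitivity (\sum_(i < n) (A ^+ 2 * w 0 i ^+ 2 + - (A * C) *+ 2 * (v 0 i * w 0 i)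
      + C ^+ 2 * v 0 i ^+ 2)); first by apply: eq_bigr => i _; ring.
  by rewrite !big_split/= -!mulr_sumr -/A -/B -/C; ring.
have [A00|A00] := eqVneq A 0; last first.
  by rewrite pmulr_rge0 ?subr_ge0// lt_neqAle eq_sym A00.
suff -> : C = 0 by move=> _; rewrite A00 mul0r expr0n.
apply: big1 => i _.
have /eqP : v 0 i ^+ 2 = 0.
  by apply/eqP; move/eqP: A00; rewrite psumr_eq0 => [/allP/(_ i)|j _];
    [apply; rewrite mem_index_enum|exact: sqr_ge0].
by rewrite sqrf_eq0 => /eqP ->; rewrite mul0r.
Qed.

Lemma euclD v w : eucl (v + w) <= eucl v + eucl w.
Proof.
rewrite -(@ler_pXn2r _ 2%N) ?nnegrE ?addr_ge0 ?eucl_ge0// sqrrD !eucl_sqr.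
have -> : \sum_(i < n) (v + w) 0 i ^+ 2 = \sum_(i < n) v 0 i ^+ 2 +
    (\sum_(i < n) v 0 i * w 0 i) *+ 2 + \sum_(i < n) w 0 i ^+ 2.
  rewrite -sumrMnl -!big_split/=; apply: eq_bigr => i _; rewrite mxE; ring.
rewrite lerD2r lerD2l lerMn2r/=.
exact: le_trans (ler_norm _) (eucl_cauchy_schwarz _ _).
Qed.

Lemma eucl_dist_triangle z v w : eucl (v - w) <= eucl (z - v) + eucl (z - w).
Proof.
by rewrite -(euclN (z - v)) (le_trans _ (euclD _ _))// opprB addrA subrK.
Qed.

Lemma eucl_continuous : continuous (@eucl R n).
Proof.
move=> v; apply: (@continuous_comp _ _ _ (fun v : 'rV[R]_n => \sum_(i < n) v 0 i ^+ 2)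
    Num.sqrt); last exact: sqrt_continuous.
apply: continuous_big => [|i _ {}v]; first exact: add_continuous.
apply: (@continuous_comp _ _ _ (fun v : 'rV[R]_n => v 0 i) (fun x : R => x ^+ 2)).
  exact: coord_continuous.
exact: exprn_continuous.
Qed.

End eucl_norm.

(** * Measurability of open sets *)

Section open_measurable_Rn.
Context {R : realType} {n : nat}.

(** An open set is the union of the half-open boxes with rational corners that it contains. [F]
    builds such a box from closed half-spaces by complements and a countable union. *)
Lemma open_measurable_Rn (A : set 'rV[R]_n) :
  open A -> measurable (A : set (Rn R n)).
Proof.
move=> oA.
pose H (c : R) i : set (Rn R n) := [set x | x 0 i <= c].
pose F (pq : 'rV[rat]_n * 'rV[rat]_n) : set (Rn R n) :=
  ~` (\bigcup_(i : 'I_n) ~` (~` H (ratr (pq.1 0 i)) i `&` H (ratr (pq.2 0 i)) i)).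
have mF pq : measurable (F pq).
  apply: measurableC; apply: countable_bigcupT_measurable; first exact: countableP.
  move=> i; apply: measurableC; apply: measurableI; last exact: measurable_halfspace.
  exact/measurableC/measurable_halfspace.
have -> : A = \bigcup_pq (if `[< F pq `<=` A >] then F pq else set0).
  apply/seteqP; split => [x Ax|x [pq _]]; last by case: asboolP => // FA; exact: FA.
  have [e e0 eA] : exists2 e : R, 0 < e & ball x e `<=` A by exact/nbhs_ballP/open_nbhs_nbhs.
  have hp i : exists q : rat, ratr q \in `]x 0 i - e, x 0 i[.
    by have := @rat_in_itvoo R (x 0 i - e) (x 0 i); apply; rewrite ltrBlDr ltrDl.
  have hq i : exists q : rat, ratr q \in `]x 0 i, x 0 i + e[.
    by have := @rat_in_itvoo R (x 0 i) (x 0 i + e); apply; rewrite ltrDl.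
  have [p pP] := choice hp; have [q qP] := choice hq.
  have FA : F (\row_i p i, \row_i q i) `<=` A.
    move=> y Fy; apply: eA; split=> // i j; rewrite ord1 {i}.
    have {}Fy : ~ (~` H (ratr (p j)) j `&` H (ratr (q j)) j) y -> False.
      by move=> h; apply: Fy; exists j => //=; rewrite !mxE.
    have /contrapT [/negP] := Fy; rewrite -ltNge => h1 h2.
    have := pP j; have := qP j; rewrite !in_itv/= => /andP[h3 h4] /andP[h5 h6].
    by rewrite /ball/= ltr_distlC; apply/andP; split; rewrite /H/= in h2; lra.
  exists (\row_i p i, \row_i q i) => //; case: asboolP => // _ [i _] /=; apply.
  rewrite !mxE; have := pP i; have := qP i; rewrite !in_itv/= => /andP[h3 h4] /andP[h5 h6].
  by split; [apply/negP; rewrite -ltNge|exact: ltW].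
apply: countable_bigcupT_measurable; first exact: countableP.
by move=> pq; case: (`[< _ >]).
Qed.

Lemma continuous_measurable_Rn (A : set 'rV[R]_n) (f : 'rV[R]_n -> R) :
  open A -> (forall x, A x -> {for x, continuous f}) ->
  measurable_fun (A : set (Rn R n)) (f : Rn R n -> R).
Proof.
move=> oA cf; apply: (measurability _ (RGenOpens.measurableE R)).
move=> _ [_ [a [b ->] <-]]; apply: (@open_measurable_Rn (A `&` f @^-1` `]a, b[%classic)).
rewrite openE => x [Ax fx]; apply: filterI; first exact: open_nbhs_nbhs.
by apply: cf => //; apply: open_nbhs_nbhs; split => //; exact: interval_open.
Qed.

(* The sigma-algebra of [Rn R n * R] is generated by rectangles; letting the second
   side be a rational interval makes countably many of them cover [W]. *)
Lemma open_measurable_prod (W : set ('rV[R]_n * R)) :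
  open W -> measurable (W : set (Rn R n * R)).
Proof.
move=> oW.
pose U (p : rat * rat) : set 'rV[R]_n :=
  interior [set y | forall r : R, ratr p.1 < r < ratr p.2 -> W (y, r)].
have -> : W = \bigcup_p (U p `*` `]ratr p.1, ratr p.2[%classic).
  apply/seteqP; split=> [[y r] Wyr|[y r] [p _] [/=]]; last first.
    by move=> /interior_subset; apply.
  have [[B C] [/= By Cr] BCW] : nbhs (y, r) W by exact: open_nbhs_nbhs.
  have [e /= e0 eC] := (nbhs_ballP _ _).1 Cr.
  have /rat_in_itvoo[p] : r - e < r by rewrite ltrBlDr ltrDl.
  have /rat_in_itvoo[q] : r < r + e by rewrite ltrDl.
  rewrite !in_itv/= => /andP[q1 q2] /andP[p1 p2].
  exists (p, q) => //; split; rewrite /= ?in_itv/= ?p2 ?q1//.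
  apply: filterS By => z Bz s /andP[s1 s2]; apply: BCW; split => //=.
  by apply: eC; rewrite /ball/= ltr_distlC; apply/andP; split; lra.
apply: countable_bigcupT_measurable; first exact: countableP.
move=> p; apply: measurableX => //; apply: open_measurable_Rn.
exact: open_interior.
Qed.

End open_measurable_Rn.

(** * Euclidean balls: finiteness, scaling and positivity of their measure *)

Section leb_ball.
Context {R : realType} {n : nat}.
Implicit Types (A B : set 'rV[R]_n) (r : R).
Local Open Scope ereal_scope.

Definition eucl_ball r : set 'rV[R]_n := [set x | (eucl x < r)%R].

Lemma eucl_ball_open r : open (eucl_ball r).
Proof.
by have /continuousP/(_ _ (@open_lt R r)) := @eucl_continuous R n.
Qed.

Lemma bounded_leb_lty A (M : R) :
  (forall x, A x -> forall i, `|x 0%R i| <= M)%R -> leb (A : set (Rn R n)) < +oo.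
Proof.
move=> AM; apply: (@le_lt_trans _ _
  (@lebesgue_outer R n (box (const_mx (- M)%R : 'rV[R]_n, const_mx M)))).
  by apply: le_outer_measure => x /AM xM i; rewrite !mxE -ler_norml.
by rewrite lebesgue_outer_box ltry.
Qed.

Lemma compact_leb_lty A : compact A -> leb (A : set (Rn R n)) < +oo.
Proof.
move=> /compact_bounded[M [_ /(_ (M + 1)%R)]]; rewrite ltrDl ltr01 => /(_ isT) AM.
apply: (@bounded_leb_lty _ (M + 1)%R) => x /AM + i; apply: le_trans.
rewrite [leRHS]/Num.norm/= mx_normrE.
by apply/bigmax_geP; right => /=; exists (0%R, i).
Qed.

Lemma leb_eucl_ball_lty r : leb (eucl_ball r : set (Rn R n)) < +oo.
Proof.
apply: (@bounded_leb_lty _ r) => x /ltW xr i.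
exact: le_trans (coord_le_eucl _ _) xr.
Qed.

Lemma leb_eucl_ballE r : (0 < r)%R -> leb (eucl_ball r : set (Rn R n)) =
  (r ^+ n)%:E * leb (eucl_ball 1 : set (Rn R n)).
Proof.
move=> r0; have := @lebesgue_outer_affine R n (eucl_ball r) r 0%R r0.
have -> : [set y | eucl_ball r (0 + r *: y)%R] = eucl_ball 1.
  by apply/seteqP; split => y; rewrite /eucl_ball/= add0r euclZ gtr0_norm// gtr_pMr.
move=> e; rewrite /leb e muleA -EFinM divff ?mul1e// expf_neq0//.
by rewrite gt_eqF.
Qed.

Lemma leb_eucl_ball_gt0 r : (0 < r)%R -> 0 < leb (eucl_ball r : set (Rn R n)).
Proof.
(* A cube of half-edge [r / (n + 1)] lies in the ball, because the Euclidean norm is at most the sum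
   of the [n] coordinates; dividing by [n + 1] keeps this strict. *)
move=> r0; have d0 : (0 < r / n.+1%:R)%R by rewrite divr_gt0.
set d : R := (r / n.+1%:R)%R in d0.
apply: (@lt_le_trans _ _ (lebesgue_outer (box (const_mx (- d)%R : 'rV[R]_n, const_mx d)))).
  rewrite lebesgue_outer_box lte_fin; apply: prodr_gt0 => i _.
  by rewrite !mxE/= lt_max; apply/orP; right; lra.
apply: le_outer_measure => x xd; apply: le_lt_trans (eucl_le_sum _) _.
apply: (@le_lt_trans _ _ (\sum_(i < n) d)%R).
  by apply: ler_sum => i _; have := xd i; rewrite !mxE ler_norml.
rewrite sumr_const card_ord -(mulr_natr d n) /d mulrAC ltr_pdivrMr//.
by rewrite ltr_pM2l// ltr_nat.
Qed.

Lemma unit_ball_volumeE :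
  leb (eucl_ball 1 : set (Rn R n)) = (unit_ball_volume R n)%:E.
Proof.
rewrite /unit_ball_volume fineK// ge0_fin_numE ?leb_eucl_ball_lty//.
Qed.

Lemma unit_ball_volume_gt0 : (0 < unit_ball_volume R n)%R.
Proof. by rewrite -lte_fin -unit_ball_volumeE leb_eucl_ball_gt0. Qed.

Let leb_sigma_finite : sigma_finite setT (@leb R n).
Proof.
exists (fun k => eucl_ball k%:R : set (Rn R n)).
  apply/seteqP; split => // x _; exists (Num.truncn (eucl x)).+1 => //.
  exact: truncnS_gt.
move=> k; split; last exact: leb_eucl_ball_lty.
exact/open_measurable_Rn/eucl_ball_open.
Qed.

HB.instance Definition _ :=
  @Measure_isSigmaFinite.Build _ _ _ (@leb R n) leb_sigma_finite.

Hypothesis n_gt0 : (0 < n)%N.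

(** A point is a box with an edge of length 0. This allows the origin, where [1/|y|] is singular and
    the ray has no direction, to be removed from balls at no cost. *)
Lemma leb_setD0 A :
  leb (A `\ (0%R : 'rV[R]_n) : set (Rn R n)) = leb (A : set (Rn R n)).
Proof.
apply/eqP; rewrite eq_le; apply/andP; split; first by apply: le_outer_measure => x [].
apply: (@le_trans _ _ (lebesgue_outer ([set (0%R : 'rV[R]_n)] `|` (A `\ (0%R : 'rV[R]_n))))).
  by apply: le_outer_measure => x Ax; have [->|/eqP x0] := eqVneq x 0%R; [left|right].
apply: le_trans (outer_measureU2 _ _ _) _.
rewrite [X in X + _](_ : _ = 0) ?add0e//.
apply/eqP; rewrite eq_le outer_measure_ge0 andbT.
have -> : [set 0%R] = box (0%R : 'rV[R]_n, 0%R : 'rV[R]_n).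
  apply/seteqP; split=> [x -> i|x x0]; first by rewrite lexx.
  by apply/rowP => i; apply/eqP; rewrite eq_le andbC x0.
apply: le_trans (lebesgue_outer_box_le _) _; rewrite lee_fin /box_volume (bigD1 (Ordinal n_gt0))//=.
by rewrite !mxE subrr maxxx mul0r.
Qed.

End leb_ball.

(** * Averaging over rays *)

Section inv_eucl_integral.
Context {R : realType} {n : nat}.
Hypothesis n_ge2 : (2 <= n)%N.
Local Open Scope ereal_scope.
Local Notation B' := (eucl_ball 1 `\ (0%R : 'rV[R]_n) : set (Rn R n)).

Definition inv_eucl_integral : \bar R := \int[leb]_(y in B') ((eucl y)^-1)%:E.

Let n_gt0 : (0 < n)%N. Proof. exact: leq_trans n_ge2. Qed.

Lemma punctured_ball_open : open (eucl_ball 1 `\ (0%R : 'rV[R]_n)).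
Proof.
apply: openI; first exact: eucl_ball_open.
apply: closed_openC; apply: compact_closed; first exact: norm_hausdorff.
exact: compact_set1.
Qed.

Lemma measurable_punctured_ball : measurable B'.
Proof. exact/open_measurable_Rn/punctured_ball_open. Qed.

Lemma measurable_inv_eucl : measurable_fun B' (fun y : Rn R n => ((eucl y)^-1)%:E).
Proof.
apply/measurable_EFinP; apply: (@continuous_measurable_Rn _ _ _ (fun y => (eucl y)^-1)%R).
  exact: punctured_ball_open.
move=> y [_ /eqP]; rewrite -eucl_gt0 => y0.
apply: (@continuous_comp _ _ _ (@eucl R n) (@GRing.inv R)).
  exact: eucl_continuous.
by apply: inv_continuous; rewrite gt_eqF.
Qed.

Lemma inv_eucl_integral_gt0 : 0 < inv_eucl_integral.
Proof.
apply: (@lt_le_trans _ _ (\int[leb]_(y in B') 1)).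
  rewrite integral_cst ?mul1e; last exact: measurable_punctured_ball.
  by rewrite [X in 0 < X](leb_setD0 n_gt0) leb_eucl_ball_gt0.
apply: ge0_le_integral.
- exact: measurable_punctured_ball.
- by [].
- exact: measurable_cst.
- exact: measurable_inv_eucl.
- move=> y [/ltW y1 /= /eqP y0]; rewrite lee_fin invf_ge1// eucl_gt0//.
Qed.

(* Dyadic shells: [1/|y| <= 2^(k+1)] on [2^-(k+1) <= |y| < 2^-k]. *)
Lemma inv_eucl_integral_lty : inv_eucl_integral < +oo.
Proof.
pose h k : R := (2^-1 ^+ k)%R.
have h0 k : (0 < h k)%R by rewrite exprn_gt0.
pose g k (y : Rn R n) : \bar R := ((h k.+1)^-1 * \1_(eucl_ball (h k)) y)%:E.
have mball k : measurable (eucl_ball (h k) : set (Rn R n)).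
  exact/open_measurable_Rn/eucl_ball_open.
have mg k : measurable_fun B' (g k).
  by apply/measurable_EFinP; apply: measurable_funM => //; exact: measurable_indic.
have g0 k y : 0 <= g k y by rewrite lee_fin mulr_ge0 ?invr_ge0// ltW.
have mB := measurable_punctured_ball.
apply: (@le_lt_trans _ _ (\int[leb]_(y in B') (\sum_(k <oo) g k y))).
  apply: ge0_le_integral.
  - exact: mB.
  - by move=> y _; rewrite lee_fin invr_ge0 eucl_ge0.
  - exact: measurable_inv_eucl.
  - by apply: (@ge0_emeasurable_sum _ _ _ _ g xpredT).
  - move=> y [/= y1 /eqP]; rewrite -eucl_gt0 => y0.
    have ex : exists k, (h k.+1 <= eucl y)%R.
      exists (Num.truncn (eucl y)^-1); apply/ltW; rewrite /h exprVn invf_plt ?posrE ?exprn_gt0//.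
      apply: lt_trans (truncnS_gt _) _; rewrite -natrX ltr_nat.
      exact: ltn_expl.
    have hk := ex_minnP ex; case: hk => k hk kmin.
    have yk : (eucl y < h k)%R.
      case: k hk kmin => [|k] hk kmin; first by rewrite /h expr0.
      by rewrite ltNge; apply/negP => /kmin; rewrite ltnn.
    apply: le_trans (@nneseries_lim_ge _ _ xpredT 0%N k.+1 _); last by move=> *; exact: g0.
    rewrite big_nat_recr//=; apply: (@le_trans _ _ (g k y)); last by rewrite leeDr// sume_ge0.
    rewrite /g indicE mem_set// mulr1 lee_fin lef_pV2 ?posrE//.
rewrite integral_nneseries//.
(* As [n >= 2], the factor [h k ^+ n] is at most [h k ^+ 2], so the [k]-th term is at most
   [2^(k+1) * 2^(-2k) = 4 / 2^(k+1)] times the volume of the unit ball. *)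
apply: (@le_lt_trans _ _ (\sum_(k <oo) ((4 * unit_ball_volume R n) / (2 ^ (k + 1))%:R)%:E)).
  apply: lee_nneseries => [k _ _|k _]; first exact: integral_ge0.
  rewrite /g; under eq_integral do rewrite EFinM.
  rewrite ge0_integralZl_EFin; last 4 first.
  - exact: mB.
  - by move=> y _; rewrite lee_fin.
  - by apply/measurable_EFinP; exact: measurable_indic.
  - by rewrite invr_ge0 ltW.
  rewrite integral_indic//; apply: (@le_trans _ _
    ((h k.+1)^-1%:E * leb (eucl_ball (h k) : set (Rn R n)))).
    apply: lee_wpmul2l; first by rewrite lee_fin invr_ge0 ltW.
    by apply: le_outer_measure => x [].
  rewrite leb_eucl_ballE// unit_ball_volumeE -!EFinM lee_fin mulrA addn1.
  rewrite [leRHS]mulrAC ler_pM2r ?unit_ball_volume_gt0//.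
  rewrite -[n](subnK n_ge2) exprD.
  apply: (@le_trans _ _ ((h k.+1)^-1 * h k ^+ 2)%R).
    rewrite ler_pM2l ?invr_gt0// ler_piMl ?sqr_ge0// exprn_ile1 ?(ltW (h0 _))//.
    by rewrite /h exprn_ile1// invf_le1 ?ler1n.
  have z0 : (2 ^+ k : R)%R != 0%R by rewrite expf_neq0.
  have -> : h k.+1 = (2^-1 * (2 ^+ k)^-1)%R by rewrite /h exprS exprVn.
  have -> : h k = ((2 ^+ k)^-1)%R by rewrite /h exprVn.
  have -> : (2 ^ k.+1)%:R = (2 * 2 ^+ k)%R :> R by rewrite natrX exprS.
  by rewrite le_eqVlt; apply/orP; left; apply/eqP; field.
have := @cvg_geometric_eseries_half R (4 * unit_ball_volume R n)%R 0.
by move/cvg_lim => ->//; rewrite ltry.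
Qed.

End inv_eucl_integral.

Section ray_slices.
Context {R : realType} {n : nat}.
Hypothesis n_ge2 : (2 <= n)%N.
Local Notation mu := (@lebesgue_measure R).
Local Notation B' := (eucl_ball 1 `\ (0%R : 'rV[R]_n) : set (Rn R n)).
Local Open Scope ereal_scope.

Let n_gt0 : (0 < n)%N. Proof. exact: leq_trans n_ge2. Qed.

Lemma leb_tonelli_open (W : set ('rV[R]_n * R)) : open W ->
  \int[leb]_y mu (xsection (W : set (Rn R n * R)) y) =
  \int[mu]_r leb (ysection (W : set (Rn R n * R)) r).
Proof.
move=> oW; have mW := open_measurable_prod _ oW.
have := @indic_fubini_tonelli _ _ _ _ _ (@leb R n) mu _ mW.
by rewrite indic_fubini_tonelli_FE// indic_fubini_tonelli_GE.
Qed.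

Definition ray_slice (E : set 'rV[R]_n) (x y : 'rV[R]_n) : set R :=
  [set r | (0 < r)%R /\ E (x + r *: y)%R].

Let cone (E : set 'rV[R]_n) (x : 'rV[R]_n) : set ('rV[R]_n * R) :=
  [set p | (eucl_ball 1 `\ 0%R) p.1 /\ ((0 < p.2)%R /\ E (x + p.2 *: p.1)%R)].

Let cone_open E x : open E -> open (cone E x).
Proof.
move=> oE; apply: openI.
  have /continuousP : continuous (fun p : 'rV[R]_n * R => p.1).
    by move=> p; exact: cvg_fst.
  by apply; exact: punctured_ball_open.
apply: openI.
  have /continuousP : continuous (fun p : 'rV[R]_n * R => p.2).
    by move=> p; exact: cvg_snd.
  by move=> /(_ _ (@open_gt R 0%R)).
suff /continuousP : continuous (fun p : 'rV[R]_n * R => x + p.2 *: p.1)%R by apply.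
move=> p; apply: cvgD; first exact: cvg_cst.
by apply: cvgZ; [exact: cvg_snd|exact: cvg_fst].
Qed.

Let xsection_cone E x y : B' y -> xsection (cone E x) y = ray_slice E x y.
Proof.
move=> By; apply/seteqP; split => r; rewrite /xsection/= inE.
  by case.
by move=> ?; split.
Qed.

Lemma measurable_ray_slice E x : open E ->
  measurable_fun B' (fun y => mu (ray_slice E x y)).
Proof.
move=> oE; apply: (@eq_measurable_fun _ _ (Rn R n) _ _
   (fun y => mu (xsection (cone E x : set (Rn R n * R)) y))).
  by move=> y; rewrite inE => By; rewrite xsection_cone.
apply: (@measurable_funS _ _ (Rn R n) _ setT); [exact: measurableT|exact: subsetT|].
apply: measurable_fun_xsection; apply: open_measurable_prod; exact: cone_open.
Qed.

Let integral_cone E x : open E -> \int[leb]_(y in B') mu (ray_slice E x y) =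
  \int[mu]_r leb (ysection (cone E x : set (Rn R n * R)) r).
Proof.
move=> oE; rewrite -leb_tonelli_open; last exact: cone_open.
rewrite [LHS]integral_mkcond; apply: eq_integral => y _; rewrite patchE.
case: ifPn; rewrite ?inE ?notin_setE => By; first by rewrite xsection_cone.
rewrite (_ : xsection _ _ = set0) ?measure0//.
by apply/seteqP; split => r; rewrite /xsection//= inE => -[].
Qed.

(* The cone over [E] has slices at height [r] of measure at most
   [min (leb ball) (r^-n leb E)], with equality for balls centred at [x]; so balls
   maximise its total measure, and for a ball that measure is computed fibrewise. *)
Lemma integral_ray_slice_le E x : open E -> leb (E : set (Rn R n)) < +oo ->
  \int[leb]_(y in B') mu (ray_slice E x y) <=
  ((fine (leb (E : set (Rn R n))) / unit_ball_volume R n) `^ n%:R^-1)%:E *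
  @inv_eucl_integral R n.
Proof.
move=> oE Efin; set Om := unit_ball_volume R n.
have Om0 : (0 < Om)%R := unit_ball_volume_gt0.
set rho := (_ `^ _)%R.
have rho0 : (0 <= rho)%R by exact: powR_ge0.
have Enum : leb (E : set (Rn R n)) \is a fin_num by rewrite ge0_fin_numE.
have EE : leb (E : set (Rn R n)) = (Om * rho ^+ n)%:E.
  rewrite -powR_mulrn// -powRrM mulVf ?pnatr_eq0 -?lt0n// powRr1.
    by rewrite mulrC divfK ?gt_eqF// fineK.
  by rewrite divr_ge0// ?(ltW Om0)// fine_ge0.
have oB : open (@eucl_ball R n rho) := eucl_ball_open rho.
apply: (@le_trans _ _ (\int[leb]_(y in B') mu (ray_slice (eucl_ball rho) 0%R y))).
  rewrite !integral_cone//; apply: ge0_le_integral.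
  - exact: measurableT.
  - by move=> r _; exact: outer_measure_ge0.
  - by apply: measurable_fun_ysection; apply: open_measurable_prod; exact: cone_open.
  - by apply: measurable_fun_ysection; apply: open_measurable_prod; exact: cone_open.
  move=> r _; have [r0|r0] := leP r 0%R.
    rewrite (_ : ysection _ _ = set0) ?measure0//.
    apply/seteqP; split => y; rewrite /ysection//= inE => -[_ [/=]].
    by rewrite ltNge r0.
  have [rrho|rrho] := leP r rho.
    apply: le_outer_measure => y; rewrite /ysection/= !inE => -[By _]; split => //.
    split=> //; rewrite /eucl_ball/= add0r euclZ gtr0_norm//.
    by apply: lt_le_trans rrho; rewrite gtr_pMr//; case: By.
  apply: (@le_trans _ _ (lebesgue_outer [set y | E (x + r *: y)%R])).
    by apply: le_outer_measure => y; rewrite /ysection/= inE => -[_ [_]].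
  rewrite lebesgue_outer_affine// [X in _ * X]EE.
  have [rho_eq0|rho_neq0] := eqVneq rho 0%R.
    rewrite rho_eq0 expr0n eqn0Ngt n_gt0/= mulr0 mule0; exact: outer_measure_ge0.
  have rho_gt0 : (0 < rho)%R by rewrite lt_neqAle eq_sym rho_neq0.
  apply: (@le_trans _ _ (leb (eucl_ball (rho / r) `\ (0%R : 'rV[R]_n) : set (Rn R n)))).
    rewrite (leb_setD0 n_gt0) leb_eucl_ballE ?divr_gt0// unit_ball_volumeE -!EFinM lee_fin.
    by rewrite le_eqVlt; apply/orP; left; apply/eqP; rewrite expr_div_n -/Om; ring.
  apply: le_outer_measure => y [yr y0]; rewrite /ysection/= inE; split.
    by split=> //; rewrite /eucl_ball/=; apply: lt_trans yr _; rewrite ltr_pdivrMr// mul1r.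
  split=> //; rewrite /eucl_ball/= add0r euclZ gtr0_norm// mulrC -ltr_pdivlMr//.
rewrite -ge0_integralZl_EFin; last 4 first.
- exact: measurable_punctured_ball.
- by move=> y _; rewrite lee_fin invr_ge0 eucl_ge0.
- exact: measurable_inv_eucl.
- exact: rho0.
rewrite le_eqVlt; apply/orP; left; apply/eqP; apply: eq_integral => y.
rewrite inE => -[_ /eqP]; rewrite -eucl_gt0 => y0.
(* The ray [r y] leaves the ball at [r = rho / |y|]: this is the origin of the weight [1/|y|]. *)
have -> : ray_slice (eucl_ball rho) 0%R y = `]0%R, (rho / eucl y)%R[%classic.
  apply/seteqP; split => r; rewrite /ray_slice/eucl_ball/= add0r euclZ in_itv/=.
    by move=> [r0]; rewrite gtr0_norm// ltr_pdivlMr// r0.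
  by move=> /andP[r0 rr]; rewrite gtr0_norm// -ltr_pdivlMr//.
rewrite lebesgue_measure_itv/= lte_fin.
case: ifPn => [_|]; first by rewrite sube0.
rewrite -leNgt -EFinM => h.
have -> : (rho / eucl y = 0)%R by apply/eqP; rewrite eq_le h divr_ge0 ?eucl_ge0.
by [].
Qed.

End ray_slices.

(** * Continuously differentiable functions and their derivatives along rays *)

Definition is_C1 {R : realType} {n : nat} (phi : 'rV[R]_n -> R) : Prop :=
  continuous phi /\ forall i, (forall x, derivable phi x (delta_mx 0 i)) /\
    continuous (partial i phi).

Section C1_functions.
Context {R : realType} {n : nat}.
Implicit Types (phi : 'rV[R]_n -> R) (x y z : 'rV[R]_n).

Lemma is_derive_line phi x y (t : R) : derivable phi (x + t *: y) y ->
  is_derive t (1 : R) (fun s => phi (x + s *: y)) ('D_y phi (x + t *: y)).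
Proof.
move=> d.
have E : (fun h : R => h^-1 *: (((fun s => phi (x + s *: y)) \o shift t) (h *: 1) -
      phi (x + t *: y))) =
    (fun h : R => h^-1 *: ((phi \o shift (x + t *: y)) (h *: y) - phi (x + t *: y))).
  apply/funext => h /=; congr (_ *: (phi _ - _)).
  have -> : h *: (1 : R) = h by rewrite /GRing.scale/= mulr1.
  by rewrite scalerDl addrCA.
by apply: DeriveDef; rewrite /derivable /derive E.
Qed.

Lemma line_continuous x y : continuous (fun s : R => x + s *: y).
Proof.
move=> s; apply: cvgD; first exact: cvg_cst.
by apply: cvgZ; [exact: cvg_id|exact: cvg_cst].
Qed.

Lemma C1_mvt_coord phi z i (t : R) : is_C1 phi -> exists s : R, `|s| <= `|t| /\
  phi (z + t *: delta_mx 0 i) - phi z = t * partial i phi (z + s *: delta_mx 0 i).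
Proof.
move=> [cphi /(_ i)[dphi _]].
pose g (s : R) := phi (z + s *: delta_mx 0 i).
have dg s : is_derive s (1 : R) g (partial i phi (z + s *: delta_mx 0 i)).
  exact: is_derive_line.
have cg (A : set R) : {within A, continuous g}.
  apply: continuous_subspaceT => s; apply: continuous_comp; last exact: cphi.
  exact: line_continuous.
have g0 : g 0 = phi z by rewrite /g scale0r addr0.
have [t0|t0] := leP 0 t.
  have [s sI e] := MVT_segment t0 (fun s _ => dg s) (cg _).
  exists s; split; last by rewrite -g0 -/(g t) e subr0 mulrC.
  by move: sI; rewrite in_itv/= => /andP[s0 st]; rewrite !ger0_norm.
have [s sI e] := MVT_segment (ltW t0) (fun s _ => dg s) (cg _).
exists s; split.
  by move: sI; rewrite in_itv/= => /andP[s0 st]; rewrite !ler0_norm ?lerN2// ltW.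
by rewrite -g0 -/(g t) -opprB e sub0r mulrN opprK mulrC.
Qed.

Let trunc y (k : nat) : 'rV[R]_n := \row_j (if (j < k)%N then y 0 j else 0).

Let truncS y (k : 'I_n) : trunc y k.+1 = trunc y k + y 0 k *: delta_mx 0 k.
Proof.
apply/rowP => j; rewrite !mxE eqxx/= eq_sym ltnS leq_eqVlt.
rewrite -[(k == j)]/(val k == val j) eq_sym.
case: eqP => [/= jk|_]; last by rewrite mulr0 addr0.
by rewrite jk ltnn/= add0r mulr1; congr (y 0 _); exact: val_inj.
Qed.

(** The segment from [z] to [z + h y] is replaced by the axis-parallel path with vertices
    [z + h * trunc y k]; the mean value theorem on its [k]-th edge supplies [q k]. The coordinate
    bounds are what makes [q k] tend to [z] with [h]. *)
Let C1_increment phi z y (h : R) : is_C1 phi -> exists q : 'I_n -> 'rV[R]_n,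
  (forall k j, `|q k 0 j - z 0 j| <= `|h| * `|y 0 j|) /\
  phi (z + h *: y) - phi z = h * \sum_k y 0 k * partial k phi (q k).
Proof.
move=> C1phi.
have H (k : 'I_n) : exists q : 'rV[R]_n, (forall j, `|q 0 j - z 0 j| <= `|h| * `|y 0 j|) /\
    phi (z + h *: trunc y k.+1) - phi (z + h *: trunc y k) = h * (y 0 k * partial k phi q).
  have [s [sle e]] := C1_mvt_coord _ (z + h *: trunc y k) k (h * y 0 k) C1phi.
  exists (z + h *: trunc y k + s *: delta_mx 0 k); split; last first.
    by rewrite mulrA -e truncS scalerDr scalerA addrA.
  move=> j; rewrite !mxE eqxx/= -addrA addrAC subrr add0r.
  case: ifPn => jk.
    by rewrite -[j == k]/(val j == val k) (ltn_eqF jk)/= mulr0 addr0 normrM.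
  rewrite mulr0 add0r; case: eqP => [->|_]/=; first by rewrite mulr1 -normrM.
  by rewrite mulr0 normr0 mulr_ge0.
have [q qP] := choice H; exists q; split => [k j|]; first exact: (qP k).1.
rewrite mulr_sumr; under eq_bigr do rewrite -(qP _).2.
rewrite -(big_mkord xpredT (fun k => phi (z + h *: trunc y k.+1) - phi (z + h *: trunc y k))).
rewrite telescope_sumr//.
have -> : trunc y n = y by apply/rowP => j; rewrite mxE ltn_ord.
have -> : trunc y 0 = 0 by apply/rowP => j; rewrite !mxE.
by rewrite scaler0 addr0.
Qed.

(** The partial derivatives are continuous and the intermediate points converge to [z], so
    derivability along the axes yields it in every direction. *)
Lemma C1_is_derive phi z y : is_C1 phi ->
  is_derive z y phi (\sum_k y 0 k * partial k phi z).
Proof.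
move=> C1phi; have [q qP] := choice (fun h => C1_increment phi z y h C1phi).
suff L : h^-1 *: ((phi \o shift z) (h *: y) - phi z) @[h --> 0^'] -->
    \sum_k y 0 k * partial k phi z.
  by apply: DeriveDef; [apply/cvg_ex; exists (\sum_k y 0 k * partial k phi z)|apply/cvg_lim].
have qz k : q h k @[h --> (0 : R)^'] --> z.
  have S0 : 0 <= \sum_j `|y 0 j| by exact: sumr_ge0.
  have S1 : 0 < \sum_j `|y 0 j| + 1 by rewrite ltr_wpDl.
  apply/cvg_ballP => e e0; near=> h; split => // i j; rewrite ord1 {i}.
  rewrite /ball/= distrC (le_lt_trans ((qP h).1 k j))//.
  apply: (@le_lt_trans _ _ (`|h| * \sum_j `|y 0 j|)).
    by rewrite ler_wpM2l// (bigD1 j)//= lerDl sumr_ge0.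
  apply: (@le_lt_trans _ _ (`|h| * (\sum_j `|y 0 j| + 1))); first by rewrite ler_wpM2l// lerDl.
  rewrite -ltr_pdivlMr//; near: h; apply: dnbhs0_lt; exact: divr_gt0.
have : \sum_k y 0 k * partial k phi (q h k) @[h --> (0:R)^'] --> \sum_k y 0 k * partial k phi z.
  apply: cvg_big => [|i _]; first exact: add_continuous.
  apply: cvgM; first exact: cvg_cst.
  exact: (cvg_comp _ _ (qz i) ((C1phi.2 i).2 z)).
apply: cvg_trans; apply: near_eq_cvg; near=> h.
have h0 : h != 0 by near: h; exact: nbhs_dnbhs_neq.
by rewrite /= (addrC (h *: y) z) (qP h).2 /GRing.scale/= mulKf.
Unshelve. all: by end_near. Qed.

Lemma grad_continuous phi : is_C1 phi -> continuous (eucl \o grad phi).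
Proof.
move=> [_ C1phi] z; apply: continuous_comp; last exact: eucl_continuous.
move=> A /nbhs_ballP[e /= e0 eA].
have H k : \forall w \near z, `|partial k phi z - partial k phi w| < e.
  by apply: ((C1phi k).2 z (ball (partial k phi z) e)); exact: nbhsx_ballx.
have nb := @filter_forall _ _ _ (nbhs z) (nbhs_filter z) H.
apply: (@filterS _ (nbhs z) (nbhs_filter z) _ _ _ nb) => w Hw; apply: eA; split => // i j.
by rewrite ord1 /grad !mxE; exact: Hw.
Qed.

Lemma compact_support_bounded (f : 'rV[R]_n -> R) (K : set 'rV[R]_n) :
  compact K -> continuous f -> (forall x, ~ K x -> f x = 0) ->
  exists M, forall x, `|f x| <= M.
Proof.
move=> cK cf f0.
have /compact_bounded[M [_ /(_ (`|M| + 1))]] : compact (f @` K).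
  by apply: continuous_compact => //; exact: continuous_subspaceT.
have M1 : M < `|M| + 1 by rewrite (le_lt_trans (ler_norm _))// ltrDl.
move=> /(_ M1) KM; exists (`|M| + 1) => x.
have [Kx|nKx] := pselect (K x); first by apply: KM; exists x.
by rewrite f0// normr0 addr_ge0.
Qed.

Lemma grad_eq0 phi (K : set 'rV[R]_n) x : compact K ->
  (forall x, ~ K x -> phi x = 0) -> ~ K x -> grad phi x = 0.
Proof.
move=> cK phi0 nKx; apply/rowP => i; rewrite !mxE /partial.
have nbK : \forall w \near x, ~ K w.
  apply: open_nbhs_nbhs; split => //; apply: closed_openC; exact: compact_closed.
rewrite (@near_eq_derive _ _ _ phi (cst 0))//; first by rewrite derive_cst.
by apply: filterS nbK => w /phi0.
Qed.

End C1_functions.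

(** For [d > 0], at least [a / d] of the levels [0, d, 2d, ...] lie below [a], because level 0 is
    included; this makes the layers an upper bound. In [rearr_layer_sum] the levels start at [d] to
    make them a lower bound. *)
Lemma layer_sum_ge {R : realType} (a d : R) N : 0 <= d -> 0 <= a -> a <= N%:R * d ->
  a <= \sum_(k < N) if k%:R * d < a then d else 0.
Proof.
move=> d0 a0; elim: N => [|N IH]; first by rewrite mul0r big_ord0.
move=> aN; have [/IH h|aN'] := leP a (N%:R * d).
  by rewrite big_ord_recr/= (le_trans h)// lerDl; case: ifP.
rewrite (eq_bigr (fun=> d)) => [|k _].
  by rewrite sumr_const card_ord -[d *+ _]mulr_natl.
by rewrite (le_lt_trans _ aN')// ler_wpM2r// ler_nat -ltnS.
Qed.

Section ray_bound.
Context {R : realType} {n : nat}.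
Local Notation mu := (@lebesgue_measure R).
Variables (phi : 'rV[R]_n -> R) (K : set 'rV[R]_n).
Hypotheses (C1phi : is_C1 phi) (cK : compact K) (phi0 : forall x, ~ K x -> phi x = 0).

Definition grad_level (s : R) : set 'rV[R]_n := [set z | s < eucl (grad phi z)].

Lemma grad_level_open s : open (grad_level s).
Proof.
by have /continuousP/(_ _ (@open_gt R s)) := grad_continuous phi C1phi.
Qed.

Lemma grad_level_subset s : 0 <= s -> grad_level s `<=` K.
Proof.
move=> s0 z; rewrite /grad_level/=; apply: contraPP => /(grad_eq0 phi K z cK phi0) ->.
by rewrite eucl0 => /lt_geF; rewrite s0.
Qed.

Lemma ray_bound (d : R) N x y : 0 <= d ->
  (forall z, eucl (grad phi z) <= N%:R * d) -> y != 0 ->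
  ((`|phi x| / eucl y)%:E <=
   \sum_(k < N) d%:E * mu (ray_slice (grad_level (k%:R * d)) x y))%E.
Proof.
move=> d0 fN y0.
have ey0 : 0 < eucl y by rewrite eucl_gt0.
(* Points of [K] have norm at most [|M| + 1], and [T] is chosen to give [x + T y] norm at least
   [|M| + 2]. *)
have [T T0 phiT] : exists2 T, 0 < T & phi (x + T *: y) = 0.
  have [M [_ /(_ (`|M| + 1))]] := compact_bounded cK.
  have -> : M < `|M| + 1 by rewrite (le_lt_trans (ler_norm _))// ltrDl.
  move=> /(_ isT) KM; have ny : 0 < `|y| by rewrite normr_gt0.
  exists ((`|M| + 1 + `|x| + 1) / `|y|).
    by rewrite divr_gt0// ltr_wpDl// !addr_ge0.
  apply: phi0 => /KM; apply/negP; rewrite -ltNge.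
  set t := _ / _; have h : `|t *: y| - `|x| <= `|x + t *: y| by rewrite (addrC x) lerB_normD.
  apply: lt_le_trans h; rewrite /t.
  rewrite normrZ ger0_norm ?divr_ge0 ?addr_ge0// divfK ?gt_eqF//; lra.
pose g r := phi (x + r *: y).
pose g' r := \sum_i y 0 i * partial i phi (x + r *: y).
have dg r : is_derive r (1 : R) g (g' r).
  have [dphi dphiE] := C1_is_derive phi (x + r *: y) y C1phi.
  by rewrite /g' -dphiE; exact: is_derive_line.
have cg : continuous g.
  move=> r; apply: continuous_comp; first exact: line_continuous.
  exact: C1phi.1.
have cg' : continuous g'.
  apply: continuous_big => [|i _ r]; first exact: add_continuous.
  apply: cvgM; first exact: cvg_cst.
  apply: (@continuous_comp _ _ _ (fun r : R => x + r *: y)); first exact: line_continuous.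
  exact: (C1phi.2 i).2.
have FTC : (\int[mu]_(r in `[0%R, T]) (g' r)%:E = (- phi x)%:E)%E.
  rewrite (@continuous_FTC2 _ g' g)//.
  - by rewrite /g phiT scale0r addr0 sub0e.
  - exact: continuous_subspaceT.
  - split; [by move=> r _; case: (dg r)| |].
      exact/cvg_at_right_filter/cg.
    exact/cvg_at_left_filter/cg.
  - by move=> r _; rewrite derive1E; case: (dg r).
have mg' D : measurable_fun D g' by apply: measurable_funTS; exact: continuous_measurable_fun.
pose A k := [set r : R | grad_level (k%:R * d) (x + r *: y)].
have mA k : measurable (A k).
  apply: open_measurable; apply: ((continuousP _).1 (line_continuous x y)).
  exact: grad_level_open.
have bnd r : `|g' r| <= \sum_(k < N) eucl y * d * \1_(A k) r.
  apply: (@le_trans _ _ (eucl y * eucl (grad phi (x + r *: y)))).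
    have -> : g' r = \sum_i y 0 i * (grad phi (x + r *: y)) 0 i.
      by apply: eq_bigr => i _; rewrite mxE.
    exact: eucl_cauchy_schwarz.
  apply: (le_trans (ler_wpM2l (ltW ey0) (layer_sum_ge _ _ N d0 (eucl_ge0 _) (fN _)))).
  rewrite mulr_sumr; apply: ler_sum => k _; rewrite -mulrA ler_wpM2l ?(ltW ey0)//.
  by case: ifPn => h; [rewrite indicE mem_set ?mulr1|rewrite mulr_ge0].
have mT : measurable (`]0, T]%classic : set R) by exact: measurable_itv.
rewrite EFinM lee_pdivrMr//.
(* The endpoint 0 is dropped because [ray_slice] consists of positive parameters. *)
apply: (@le_trans _ _ (\int[mu]_(r in `]0%R, T]) (`|g' r|)%:E)%E).
  rewrite integral_itv_obnd_cbnd; last by apply/measurable_EFinP/measurableT_comp.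
  apply: le_trans (@le_abse_integral _ _ _ mu `[0, T]%classic (EFin \o g') _ _) => //.
    by rewrite FTC/= normrN.
  by apply/measurable_EFinP; exact: mg'.
apply: (@le_trans _ _ (\int[mu]_(r in `]0%R, T])
    (\sum_(k < N) (eucl y * d * \1_(A k) r)%:E))%E).
  apply: ge0_le_integral.
  - exact: mT.
  - by move=> r _; rewrite lee_fin.
  - by apply/measurable_EFinP/measurableT_comp => //; exact: mg'.
  - by apply: emeasurable_sum => k; apply/measurable_EFinP; apply: measurable_funM;
    [exact: measurable_cst|apply: measurable_indic; exact: mA].
  - by move=> r _; rewrite sumEFin lee_fin.
rewrite ge0_integral_sum//; last 2 first.
- by move=> k; apply/measurable_EFinP; apply: measurable_funM;
    [exact: measurable_cst|apply: measurable_indic; exact: mA].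
- by move=> k r _; rewrite lee_fin !mulr_ge0 ?(ltW ey0).
rewrite muleC ge0_sume_distrr; last by move=> k _; rewrite mule_ge0// lee_fin.
apply: lee_sum => k _; under eq_integral do rewrite EFinM.
rewrite ge0_integralZl_EFin//; last 2 first.
- by apply/measurable_EFinP; apply: measurable_indic; exact: mA.
- by rewrite mulr_ge0// ltW.
rewrite integral_indic//; last exact: mA.
rewrite EFinM -muleA.
apply: lee_wpmul2l; first by rewrite lee_fin ltW.
apply: lee_wpmul2l; first by rewrite lee_fin.
apply: le_outer_measure => r [Ar]; rewrite /= in_itv/= => /andP[r0 _].
by split.
Qed.

End ray_bound.

(** * Level sets and Lorentz functionals *)

Section level_sum.
Context {R : realType} {n : nat}.
Hypothesis n_ge2 : (2 <= n)%N.
Local Notation mu := (@lebesgue_measure R).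
Local Notation B' := (eucl_ball 1 `\ (0%R : 'rV[R]_n) : set (Rn R n)).

Lemma pointwise_level_sum (phi : 'rV[R]_n -> R) (K : set 'rV[R]_n) (d : R) N x :
  is_C1 phi -> compact K -> (forall x, ~ K x -> phi x = 0) -> 0 <= d ->
  (forall z, eucl (grad phi z) <= N%:R * d) ->
  `|phi x| <= \sum_(k < N) d * (fine (leb (grad_level phi (k%:R * d) : set (Rn R n))) /
    unit_ball_volume R n) `^ n%:R^-1.
Proof.
move=> C1phi cK phi0 d0 fN.
have mB := @measurable_punctured_ball R n.
have c0 := @inv_eucl_integral_gt0 R n n_ge2.
have cfin := @inv_eucl_integral_lty R n n_ge2.
have Ecfin : @inv_eucl_integral R n \is a fin_num by rewrite ge0_fin_numE// ltW.
have oE k : open (grad_level phi (k%:R * d)) by exact: grad_level_open.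
have Efin k : (leb (grad_level phi (k%:R * d) : set (Rn R n)) < +oo)%E.
  apply: le_lt_trans (compact_leb_lty _ cK); apply: le_outer_measure.
  by apply: grad_level_subset => //; rewrite mulr_ge0.
have mS (k : 'I_N) : measurable_fun B'
    (fun y => d%:E * mu (ray_slice (grad_level phi (k%:R * d)) x y))%E.
  by apply: measurable_funeM; exact: measurable_ray_slice.
have S0 (k : 'I_N) (y : Rn R n) :
    (0 <= d%:E * mu (ray_slice (grad_level phi (k%:R * d)) x y))%E.
  by rewrite mule_ge0// lee_fin.
rewrite -(fineK Ecfin) in c0; rewrite lte_fin in c0.
rewrite -(ler_pM2r c0) -lee_fin EFinM fineK//.
apply: (@le_trans _ _ (\int[leb]_(y in B') (`|phi x| / eucl y)%:E)%E).
  rewrite /inv_eucl_integral -ge0_integralZl_EFin; last 4 first.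
  - exact: mB.
  - by move=> y _; rewrite lee_fin invr_ge0 eucl_ge0.
  - exact: measurable_inv_eucl.
  - by [].
  by rewrite le_eqVlt; apply/orP; left; apply/eqP; apply: eq_integral.
apply: (@le_trans _ _ (\int[leb]_(y in B')
   (\sum_(k < N) d%:E * mu (ray_slice (grad_level phi (k%:R * d)) x y)))%E).
  apply: ge0_le_integral.
  - exact: mB.
  - by move=> y _; rewrite lee_fin divr_ge0// eucl_ge0.
  - under eq_fun do rewrite EFinM.
    by apply: measurable_funeM; exact: measurable_inv_eucl.
  - exact: emeasurable_sum.
  - by move=> y [_ /eqP y0]; exact: (ray_bound phi K C1phi cK phi0 d N x y d0 fN y0).
rewrite ge0_integral_sum; last 3 first.
- exact: mB.
- exact: mS.
- by move=> k y _; exact: S0.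
rewrite mulr_suml -sumEFin; apply: lee_sum => k _.
rewrite ge0_integralZl_EFin; last 4 first.
- exact: mB.
- by move=> y _; exact: measure_ge0.
- exact: measurable_ray_slice.
- exact: d0.
rewrite -mulrA EFinM; apply: lee_wpmul2l; first by rewrite lee_fin.
by rewrite EFinM fineK//; exact: integral_ray_slice_le.
Qed.

End level_sum.

Section lorentz_lower_bound.
Context {R : realType} {n : nat}.
Hypothesis n_gt0 : (0 < n)%N.
Local Notation mu := (@lebesgue_measure R).
Variables (Omega : set 'rV[R]_n) (f : 'rV[R]_n -> R).
Local Notation lam := (distribution_fun Omega f).
Local Open Scope ereal_scope.

Lemma distribution_fun_ge0 t : 0 <= lam t.
Proof. exact: outer_measure_ge0. Qed.

Lemma le_distribution_fun (s t : R) : (s <= t)%R -> lam t <= lam s.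
Proof.
move=> st; apply: le_outer_measure => x [Ox /= h]; split => //=.
exact: le_lt_trans h.
Qed.

Lemma rearr_ge0 t : 0 <= rearr Omega f t.
Proof. by apply: le_ereal_inf_tmp => _ [v [v0 _] <-]; rewrite lee_fin. Qed.

Lemma rearr_ge (s t : R) : t%:E < lam s -> s%:E <= rearr Omega f t.
Proof.
move=> ts; apply: le_ereal_inf_tmp => _ [v [v0 lv] <-].
rewrite lee_fin leNgt; apply/negP => /ltW/le_distribution_fun ls.
by have := lt_le_trans ts (le_trans ls lv); rewrite ltxx.
Qed.

Lemma le_rearr (s t : R) : (s <= t)%R -> rearr Omega f t <= rearr Omega f s.
Proof.
move=> st; apply: ereal_inf_le_tmp => _ [v [v0 lv] <-]; exists v => //; split => //.
by apply: le_trans lv _; rewrite lee_fin.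
Qed.

Lemma measurable_rearr D : measurable_fun D (rearr Omega f).
Proof.
apply: (@measurable_funS _ _ _ _ setT) => //.
apply: (measurability _ (ErealGenOInfty.measurableE R)) => _ [_ [a ->] <-].
rewrite setTI; apply: is_interval_measurable => s t /=.
rewrite !in_itv/= !andbT => fs ft u /andP[su ut].
by rewrite in_itv/= andbT (lt_le_trans ft)// le_rearr.
Qed.

Let weight (t : R) : R := (t `^ n%:R^-1 / t)%R.

Lemma lorentz_ge0 : 0 <= lorentz Omega f.
Proof.
apply: integral_ge0 => t; rewrite /= in_itv/= andbT => t0.
by rewrite mule_ge0 ?rearr_ge0// lee_fin divr_ge0 ?powR_ge0 ?ltW.
Qed.

Let powR_cont (t : R) a : (0 < t)%R -> {for t, continuous (fun t : R => (t `^ a)%R)}.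
Proof.
move=> t0; apply: differentiable_continuous; apply/derivable1_diffP.
by apply: derivable_powR; rewrite in_itv/= t0.
Qed.

Let weight_cont (t : R) : (0 < t)%R -> {for t, continuous weight}.
Proof.
move=> t0; apply: cvgM; first exact: powR_cont.
by apply: inv_continuous; rewrite gt_eqF.
Qed.

Let weight_ge0 (t : R) : (0 <= t)%R -> (0 <= weight t)%R.
Proof. by move=> t0; rewrite divr_ge0// powR_ge0. Qed.

Lemma measurable_lorentz_weight :
  measurable_fun (`]0%R, +oo[%classic : set R) (fun t : R => t `^ n%:R^-1 / t)%R.
Proof.
apply: open_continuous_measurable_fun; first exact: interval_open.
by move=> t; rewrite inE/= in_itv/= andbT => /weight_cont.
Qed.

Let integral_weight (e b : R) : (0 < e < b)%R ->
  \int[mu]_(t in `[e, b]) (weight t)%:E =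
  (n%:R * (b `^ n%:R^-1 - e `^ n%:R^-1))%:E.
Proof.
move=> /andP[e0 eb]; have n0 : (n%:R != 0 :> R)%R by rewrite pnatr_eq0 -lt0n.
have I0 t : t \in `[e, b]%R -> (0 < t)%R.
  by rewrite in_itv/= => /andP[et _]; exact: lt_le_trans et.
rewrite (@continuous_FTC2 _ weight (fun t => n%:R * t `^ n%:R^-1)%R)//.
- by rewrite -EFinB mulrBr.
- apply: continuous_in_subspaceT => t; rewrite inE/= => /I0; exact: weight_cont.
- split.
  + move=> t /subset_itv_oo_cc/I0 t0; apply: derivableM => //.
    by apply: derivable_powR; rewrite in_itv/= t0.
  + apply: cvgM; first exact: cvg_cst.
    by apply: cvg_at_right_filter; exact: powR_cont.
  + apply: cvgM; first exact: cvg_cst.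
    by apply: cvg_at_left_filter; apply: powR_cont; exact: lt_trans eb.
- move=> t /subset_itv_oo_cc/I0 t0.
  have dp : derivable (fun t : R => t `^ n%:R^-1)%R t 1%R.
    by apply: derivable_powR; rewrite in_itv/= t0.
  have := @deriveZ _ _ _ (fun t : R => t `^ n%:R^-1)%R n%:R t 1%R dp.
  rewrite derive1E => ->; rewrite -derive1E powR_derive1 ?in_itv/= ?t0//.
  rewrite /GRing.scale/= mulrA divff// mul1r /weight powRB ?(gt_eqF t0) ?implybT//.
  by rewrite powRr1// ltW.
Qed.

(** The weight has antiderivative [n t^(1/n)]; this is where the factor [n] of the final constant
    arises. The weight is singular at 0 and [l] may be infinite, so the integral is bounded below on
    compact intervals [[e, b]]. *)
Lemma integral_lorentz_weight_ge (l : \bar R) : 0 <= l ->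
  n%:R%:E * l `^ n%:R^-1 <=
  \int[mu]_(t in `]0%R, +oo[ `&` [set t | t%:E < l]) (t `^ n%:R^-1 / t)%:E.
Proof.
move=> l0; set I := integral _ _ _.
have n0 : (0 < n%:R :> R)%R by rewrite ltr0n.
have I0 : 0 <= I.
  apply: integral_ge0 => t [/=]; rewrite in_itv/= andbT => t0 _.
  by rewrite lee_fin; apply: weight_ge0; exact: ltW.
have mD : measurable (`]0%R, +oo[ `&` [set t : R | t%:E < l]).
  apply: measurableI => //; apply: is_interval_measurable => s t /= _ tl u /andP[_ ut].
  by apply: le_lt_trans tl; rewrite lee_fin.
have H (b : R) : (0 < b)%R -> b%:E <= l -> (n%:R * b `^ n%:R^-1)%:E <= I.
  move=> b0 bl; apply/lee_addgt0Pr => eta eta0.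
  (* The first entry ensures [e < b]; the second makes the loss [n e^(1/n)] on the removed part at
     most [eta]. *)
  pose e : R := (Num.min (b / 2) ((eta / n%:R) ^+ n))%R.
  have e0 : (0 < e)%R by rewrite lt_min divr_gt0// exprn_gt0// divr_gt0.
  have eb : (e < b)%R by rewrite gt_min; apply/orP; left; lra.
  have en : (n%:R * e `^ n%:R^-1 <= eta)%R.
    rewrite mulrC -ler_pdivlMr//.
    apply: (@le_trans _ _ (((eta / n%:R) ^+ n) `^ n%:R^-1)%R).
      rewrite ge0_ler_powR ?invr_ge0 ?nnegrE ?(ltW e0) ?exprn_ge0 ?divr_ge0 ?(ltW eta0)//.
      by rewrite ge_min lexx orbT.
    rewrite -powR_mulrn ?divr_ge0 ?(ltW eta0)// -powRrM mulfV ?gt_eqF// powRr1//.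
    by rewrite divr_ge0 ?(ltW eta0).
  apply: (@le_trans _ _ (\int[mu]_(t in `[e, b]) (weight t)%:E + eta%:E)).
    rewrite integral_weight ?e0// -EFinD lee_fin; lra.
  apply: leeD2r.
  rewrite -integral_itv_bndo_bndc; last first.
    apply/measurable_EFinP; apply: measurable_funS measurable_lorentz_weight => //.
    by move=> t /=; rewrite !in_itv/= andbT => /andP[/(lt_le_trans e0)].
  apply: ge0_subset_integral.
  - exact: measurable_itv.
  - exact: mD.
  - apply/measurable_EFinP; apply: measurable_funS measurable_lorentz_weight.
      exact: measurable_itv.
    by move=> t [].
  - by move=> t [/=]; rewrite in_itv/= andbT => t0 _; rewrite lee_fin weight_ge0 ?ltW.
  - move=> t /=; rewrite !in_itv/= andbT => /andP[/(lt_le_trans e0) -> tb]; split => //.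
    by apply: lt_le_trans bl; rewrite lte_fin.
clearbody I; case: l l0 {mD} H => [l||] l0 H //.
  have [->|lneq0] := eqVneq l 0%R; first by rewrite poweR0r ?mule0 ?invr_neq0 ?gt_eqF.
  by rewrite poweR_EFin -EFinM; apply: H => //; rewrite lt_neqAle eq_sym lneq0 -lee_fin.
(* For [l = +oo], taking [b = (A / n)^n] makes the lower bound equal to an arbitrary [A > 0]. *)
rewrite poweRyr ?invr_neq0 ?gt_eqF// gt0_muley ?lte_fin// leye_eq; apply/eqP/eqyP => A A0.
apply: le_trans (H ((A / n%:R) ^+ n)%R _ _); rewrite ?leey ?exprn_gt0 ?divr_gt0//.
rewrite lee_fin -powR_mulrn ?divr_ge0 ?(ltW A0)// -powRrM mulfV ?gt_eqF// powRr1//.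
  by rewrite mulrC divfK// gt_eqF.
by rewrite divr_ge0 ?(ltW A0).
Qed.

(** If the highest level counts, all lower ones count as well, and the sum is that level itself,
    which [rearr_ge] bounds; otherwise the last term is 0. *)
Lemma rearr_layer_sum (d t : R) N : (0 <= d)%R ->
  \sum_(k < N) (if t%:E < lam (k.+1%:R * d)%R then d%:E else 0) <= rearr Omega f t.
Proof.
move=> d0; elim: N => [|N IH]; first by rewrite big_ord0; exact: rearr_ge0.
have [tl|tl] := boolP (t%:E < lam (N.+1%:R * d)%R); last first.
  by rewrite big_ord_recr/= (negbTE tl) adde0.
apply: le_trans (rearr_ge _ _ tl).
rewrite (eq_bigr (fun=> d%:E)) => [|k _].
  by rewrite sumEFin sumr_const card_ord -[(d *+ _)%R]mulr_natl.
rewrite (lt_le_trans tl)// le_distribution_fun// ler_wpM2r// ler_nat.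
exact: ltn_ord.
Qed.

(** Integrate [rearr_layer_sum] against the weight: the layer of level [s] occupies [0 < t < lam s],
    where the weight has integral at least [n (lam s)^(1/n)]. *)
Lemma lorentz_ge_level_sum (d : R) N : (0 <= d)%R ->
  n%:R%:E * (\sum_(k < N) d%:E * lam (k.+1%:R * d)%R `^ n%:R^-1) <= lorentz Omega f.
Proof.
move=> d0; have mI : measurable (`]0%R, +oo[%classic : set R) by exact: measurable_itv.
pose A k : set R := [set t | t%:E < lam (k.+1%:R * d)%R].
have mA k : measurable (A k).
  apply: is_interval_measurable => s t /= _ tl u /andP[_ ut].
  by apply: le_lt_trans tl; rewrite lee_fin.
have mw : measurable_fun (`]0%R, +oo[%classic : set R) (fun t : R => (weight t)%:E).
  by apply/measurable_EFinP; exact: measurable_lorentz_weight.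
have mg k : measurable_fun (`]0%R, +oo[%classic : set R)
    (fun t : R => d%:E * ((weight t)%:E * (\1_(A k) t)%:E)).
  apply: measurable_funeM; apply: emeasurable_funM => //.
  by apply/measurable_EFinP; exact: measurable_indic.
have g0 k (t : R) : `]0%R, +oo[%classic t -> 0 <= (weight t)%:E * (\1_(A k) t)%:E.
  by rewrite /= in_itv/= andbT => t0; rewrite -EFinM lee_fin mulr_ge0// weight_ge0// ltW.
apply: (@le_trans _ _ (\int[mu]_(t in `]0%R, +oo[)
    (\sum_(k < N) d%:E * ((weight t)%:E * (\1_(A k) t)%:E)))).
  rewrite ge0_integral_sum//; last 2 first.
    by move=> k; exact: mg.
    by move=> k t t0; apply: mule_ge0; [rewrite lee_fin|exact: g0].
  rewrite ge0_sume_distrr; last by move=> k _; rewrite mule_ge0 ?lee_fin// poweR_ge0.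
  apply: lee_sum => k _; rewrite ge0_integralZl_EFin//; last 2 first.
  - by move=> t; exact: g0.
  - apply: emeasurable_funM => //; apply/measurable_EFinP; apply: measurable_indic; exact: mA.
  rewrite muleCA; apply: lee_wpmul2l; first by rewrite lee_fin.
  apply: le_trans (integral_lorentz_weight_ge _ (distribution_fun_ge0 _)) _.
  rewrite integral_mkcondr le_eqVlt; apply/orP; left; apply/eqP.
  apply: eq_integral => t _; rewrite patchE indicE.
  by case: ifPn => h; [rewrite mule1|rewrite mule0].
apply: ge0_le_integral => //.
- by move=> t t0; apply: sume_ge0 => k _; apply: mule_ge0; [rewrite lee_fin|exact: g0].
- by apply: emeasurable_sum => k; exact: mg.
- by apply: emeasurable_funM => //; exact: measurable_rearr.
move=> t; rewrite /= in_itv/= andbT => t0.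
under eq_bigr do rewrite muleCA.
rewrite -ge0_sume_distrr; last by move=> k _; rewrite -EFinM lee_fin mulr_ge0.
apply: lee_wpmul2l; first by rewrite lee_fin weight_ge0// ltW.
apply: le_trans (rearr_layer_sum d t N d0); apply: lee_sum => k _.
rewrite indicE /A; case: ifPn => [tl|tl]; first by rewrite mem_set// mule1.
by rewrite memNset ?mule0//=; exact/negP.
Qed.

Let measurable_rearr_avg :
  measurable_fun (`]0%R, +oo[%classic : set R) (rearr_avg Omega f).
Proof.
apply: emeasurable_funM.
  apply/measurable_EFinP; apply: open_continuous_measurable_fun; first exact: interval_open.
  by move=> t; rewrite inE/= in_itv/= andbT => t0; apply: inv_continuous; rewrite gt_eqF.
apply: (@measurable_funS _ _ _ _ setT) => //.
apply: (measurability _ (ErealGenOInfty.measurableE R)) => _ [_ [a ->] <-].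
rewrite setTI; apply: is_interval_measurable => s t /=.
rewrite !in_itv/= !andbT => fs ft u /andP[su ut].
rewrite in_itv/= andbT (lt_le_trans fs)//; apply: ge0_subset_integral.
- exact: measurable_itv.
- exact: measurable_itv.
- exact: measurable_rearr.
- by move=> x _; exact: rearr_ge0.
- by apply: subset_itvl; rewrite bnd_simp.
Qed.

(** A nonincreasing function at [t] is at most its average over []0, t[]. This transfers convergence
    in the Sobolev-Lorentz norm to the functional of the sharp bound. *)
Lemma lorentz_le_lorentz_avg : lorentz Omega f <= lorentz_avg Omega f.
Proof.
have mI : measurable (`]0%R, +oo[%classic : set R) by exact: measurable_itv.
have mw : measurable_fun (`]0%R, +oo[%classic : set R) (fun t : R => (weight t)%:E).
  by apply/measurable_EFinP; exact: measurable_lorentz_weight.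
apply: ge0_le_integral.
- exact: mI.
- move=> t /=; rewrite in_itv/= andbT => t0.
  by rewrite mule_ge0 ?rearr_ge0// lee_fin; apply: weight_ge0; exact: ltW.
- by apply: emeasurable_funM => //; exact: measurable_rearr.
- by apply: emeasurable_funM => //; exact: measurable_rearr_avg.
move=> t /=; rewrite in_itv/= andbT => t0.
apply: lee_wpmul2l; first by rewrite lee_fin; apply: weight_ge0; exact: ltW.
rewrite /rearr_avg lee_pdivlMl//.
have -> : t%:E * rearr Omega f t = \int[mu]_(s in `]0%R, t[) rearr Omega f t.
  by rewrite integral_cst//= lebesgue_measure_itv/= lte_fin t0 sube0 muleC.
apply: ge0_le_integral.
- exact: measurable_itv.
- by move=> s _; exact: rearr_ge0.
- exact: measurable_cst.
- exact: measurable_rearr.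
- by move=> s /=; rewrite in_itv/= => /andP[_ /ltW]; exact: le_rearr.
Qed.

End lorentz_lower_bound.

(** * The sup bound for C^1 functions of compact support *)

Lemma exprD_superadd {R : realType} (a b : R) n : (0 < n)%N -> 0 <= a -> 0 <= b ->
  a ^+ n + b ^+ n <= (a + b) ^+ n.
Proof.
case: n => // n _ a0 b0; elim: n => [|n IH]; first by rewrite !expr1.
rewrite [leRHS]exprS; apply: (le_trans _ (ler_wpM2l (addr_ge0 a0 b0) IH)).
rewrite (exprS a n.+1) (exprS b n.+1).
have h1 : 0 <= a * b ^+ n.+1 by rewrite mulr_ge0// exprn_ge0.
have h2 : 0 <= b * a ^+ n.+1 by rewrite mulr_ge0// exprn_ge0.
lra.
Qed.

(** For finite arguments with roots [p] and [q] this is [p^n + q^n <= (p + q)^n]. It separates the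
    two sets into which a level set of the gradient is split. *)
Lemma poweR_invn_subadd {R : realType} (x y : \bar R) n : (0 < n)%N ->
  (0 <= x -> 0 <= y -> (x + y) `^ n%:R^-1 <= x `^ n%:R^-1 + y `^ n%:R^-1)%E.
Proof.
move=> n0; have N0 : n%:R^-1 != 0 :> R by rewrite invr_neq0// pnatr_eq0 -lt0n.
have oo z : (0 <= z `^ n%:R^-1 :> \bar R)%E by exact: poweR_ge0.
case: x y => [a||] [b||]//.
- rewrite !lee_fin => a0 b0.
  set p := a `^ _; set q := b `^ _.
  have p0 : 0 <= p by exact: powR_ge0.
  have q0 : 0 <= q by exact: powR_ge0.
  have inv c : 0 <= c -> (c `^ n%:R^-1) ^+ n = c :> R.
    by move=> c0; rewrite -powR_mulrn ?powR_ge0// -powRrM mulVf ?pnatr_eq0 -?lt0n// powRr1.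
  rewrite -(@ler_pXn2r _ n) ?nnegrE ?addr_ge0 ?powR_ge0// inv ?addr_ge0//.
  by rewrite -{1}(inv a a0) -{1}(inv b b0); exact: exprD_superadd.
- by move=> _ _; rewrite addey// poweRyr// addey// -ltNye (lt_le_trans _ (oo _)).
- by move=> _ _; rewrite addye// poweRyr// addye// -ltNye (lt_le_trans _ (oo _)).
- by move=> _ _; rewrite addye// poweRyr// addye.
Qed.

Lemma le_eps {R : realType} (a b c : R) : 0 <= c ->
  (forall e, 0 < e < 1 -> a <= b + c * e) -> a <= b.
Proof.
move=> c0 H; apply/ler_addgt0Pr => e e0.
have d0 : 0 < e / (c + e + 1) by rewrite divr_gt0// ltr_wpDl// addr_ge0// ltW.
have d1 : 0 < c + e + 1 by rewrite ltr_wpDl// addr_ge0// ltW.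
apply: le_trans (H (e / (c + e + 1)) _) _.
  by rewrite d0 ltr_pdivrMr// mul1r; lra.
by rewrite lerD2l mulrCA ger_pMr// ler_pdivrMr// mul1r; lra.
Qed.

Section sup_bound.
Context {R : realType} {n : nat}.
Hypothesis n_ge2 : (2 <= n)%N.
Local Notation Om := (unit_ball_volume R n).
Local Notation C := (1 / (n%:R * unit_ball_volume R n `^ n%:R^-1)).

Let n_gt0 : (0 < n)%N. Proof. exact: leq_trans n_ge2. Qed.

(* The weights [1 - e] and [e] replace the triangle inequality of the Lorentz norm:
   [{|F + G| > s}] lies in [{|F| > (1 - e) s}] union [{|G| > e s}]. *)
Lemma C1_sup_bound (Omega K : set 'rV[R]_n) (phi F G : 'rV[R]_n -> R) (e : R) x :
  is_C1 phi -> compact K -> K `<=` Omega -> (forall z, ~ K z -> phi z = 0) ->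
  (forall z, Omega z -> eucl (grad phi z) <= `|F z| + `|G z|) -> 0 < e < 1 ->
  ((`|phi x|)%:E <= C%:E * ((1 - e)^-1%:E * lorentz Omega F +
                            e^-1%:E * lorentz Omega G))%E.
Proof.
move=> C1phi cK KO phi0 FG /andP[e0 e1].
have e1' : 0 < 1 - e by lra.
have Om0 : 0 < Om := unit_ball_volume_gt0.
pose lam s := leb (grad_level phi s : set (Rn R n)).
have lamfin s : 0 <= s -> lam s \is a fin_num.
  move=> s0; rewrite ge0_fin_numE ?outer_measure_ge0//.
  by apply: le_lt_trans (compact_leb_lty _ cK); apply: le_outer_measure; exact: grad_level_subset.
pose rho s := (fine (lam s) / Om) `^ n%:R^-1.
have rho0 s : 0 <= rho s by exact: powR_ge0.
have rhoE s : 0 <= s -> (rho s)%:E = ((Om `^ n%:R^-1)^-1%:E * lam s `^ n%:R^-1)%E.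
  move=> s0; rewrite -(fineK (lamfin s s0)) poweR_EFin -EFinM; congr (_%:E).
  rewrite /rho powRM ?fine_ge0 ?invr_ge0 ?(ltW Om0) ?outer_measure_ge0// mulrC.
  by rewrite -powR_inv1 ?(ltW Om0)// powRAC powR_inv1 ?powR_ge0.
have [M fM] : exists M, forall z, `|eucl (grad phi z)| <= M.
  apply: (compact_support_bounded _ _ cK (grad_continuous phi C1phi)) => z Kz /=.
  by rewrite (grad_eq0 phi K)// eucl0.
have lamD s : 0 <= s -> (lam s `^ n%:R^-1 <=
    distribution_fun Omega F ((1 - e) * s) `^ n%:R^-1 +
    distribution_fun Omega G (e * s) `^ n%:R^-1)%E.
  move=> s0; apply: le_trans (poweR_invn_subadd _ _ _ n_gt0 (distribution_fun_ge0 _ _ _)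
    (distribution_fun_ge0 _ _ _)).
  rewrite gt0_ler_poweR ?invr_ge0// ?in_itv/= ?andbT ?leey ?outer_measure_ge0//.
    by rewrite adde_ge0// distribution_fun_ge0.
  apply: le_trans (outer_measureU2 _ _ _); apply: le_outer_measure => z sz.
  have Oz : Omega z by apply: KO; exact: (grad_level_subset phi K cK phi0 s s0).
  have [h|h] := ltP ((1 - e) * s) `|F z|; [by left|right; split => //=].
  have := FG z Oz; move: sz; rewrite /grad_level/=; lra.
apply/lee_addgt0Pr => eta eta0.
(* Level 0 is present in the pointwise bound but absent from the Lorentz lower bound; this [d] makes
   its contribution [d * rho 0] at most [eta]. *)
pose d := eta / (rho 0 + 1).
have d0 : 0 < d by rewrite divr_gt0// ltr_wpDl.
pose N := Num.truncn (`|M| / d).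
have fN z : eucl (grad phi z) <= N.+1%:R * d.
  rewrite -ler_pdivrMr//; apply/ltW; apply: le_lt_trans (truncnS_gt _).
  rewrite ler_pM2r ?invr_gt0//; apply: le_trans (ler_norm _) _.
  exact: le_trans (fM z) (ler_norm _).
have := @pointwise_level_sum R n n_ge2 phi K d N.+1 x C1phi cK phi0 (ltW d0) fN.
rewrite -lee_fin => /le_trans; apply.
rewrite big_ord_recl/= mul0r EFinD addeC; apply: leeD; last first.
  rewrite lee_fin -/(lam 0) -/(rho 0) /d -mulrA ler_piMr ?(ltW eta0)// mulrC.
  by rewrite ler_pdivrMr ?mul1r ?lerDl// ltr_wpDl.
have -> : C%:E = ((Om `^ n%:R^-1)^-1%:E * n%:R^-1%:E)%E.
  by rewrite -EFinM mul1r invfM mulrC.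
rewrite -sumEFin -muleA.
(* Splitting level [s] into [(1 - e) s] and [e s] changes the spacing of the levels from [d] to
   [a d], with [a] equal to [1 - e] or [e]. Restoring the layer height [d] costs the factor
   [a^-1]. *)
pose S (H : 'rV[R]_n -> R) a := (\sum_(k < N) (a * d)%:E *
  distribution_fun Omega H (k.+1%:R * (a * d)) `^ n%:R^-1)%E.
have S0 H a : 0 < a -> (0 <= S H a)%E.
  move=> a0; apply: sume_ge0 => k _; rewrite mule_ge0 ?poweR_ge0// lee_fin.
  by rewrite mulr_ge0// ltW.
have SL H a : 0 < a -> (S H a <= n%:R^-1%:E * lorentz Omega H)%E.
  move=> a0; rewrite lee_pdivlMl ?ltr0n//.
  by apply: lorentz_ge_level_sum => //; rewrite mulr_ge0// ltW.
have L0 H : (0 <= lorentz Omega H)%E by exact: lorentz_ge0.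
apply: (@le_trans _ _ ((Om `^ n%:R^-1)^-1%:E *
    ((1 - e)^-1%:E * S F (1 - e)%R + e^-1%:E * S G e))%E); last first.
  apply: lee_wpmul2l; first by rewrite lee_fin invr_ge0 powR_ge0.
  rewrite ge0_muleDr ?mule_ge0 ?lee_fin ?invr_ge0 ?(ltW e0) ?(ltW e1')//.
  by apply: leeD; rewrite [leRHS]muleCA; apply: lee_wpmul2l;
    rewrite ?lee_fin ?invr_ge0 ?(ltW e0) ?(ltW e1')//; exact: SL.
rewrite /S !ge0_sume_distrr; last 2 first.
- by move=> k _; rewrite mule_ge0 ?poweR_ge0// lee_fin mulr_ge0// ltW.
- by move=> k _; rewrite mule_ge0 ?poweR_ge0// lee_fin mulr_ge0// ltW.
rewrite -big_split/= ge0_sume_distrr; last first.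
  move=> k _; apply: adde_ge0; (apply: mule_ge0; first by rewrite lee_fin invr_ge0 ltW);
    by apply: mule_ge0; [rewrite lee_fin mulr_ge0// ltW|exact: poweR_ge0].
apply: lee_sum => k _.
have kd0 : 0 <= k.+1%:R * d by rewrite mulr_ge0// ltW.
rewrite -[bump 0 k]/k.+1 -/(lam _) -/(rho _) EFinM rhoE// muleCA.
apply: lee_wpmul2l; first by rewrite lee_fin invr_ge0 powR_ge0.
apply: le_trans (lee_wpmul2l _ (lamD _ kd0)) _; first by rewrite lee_fin ltW.
rewrite ge0_muleDr ?poweR_ge0// !muleA -!EFinM !mulKf ?gt_eqF//.
by rewrite !(mulrCA _ k.+1%:R).
Qed.

End sup_bound.

(** * Passage to the limit *)

Section lebesgue_null_sets.
Context {R : realType} {n : nat}.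
Local Open Scope ereal_scope.

(** Sets of outer measure 0 satisfy Caratheodory's criterion, so outer-measure estimates alone yield
    statements almost everywhere. *)
Lemma leb_negligible (N : set 'rV[R]_n) : lebesgue_outer N = 0 ->
  (@leb R n).-negligible N.
Proof.
move=> N0; exists N; split => //; apply: le_caratheodory_measurable => X.
rewrite -[leRHS]add0e -N0.
by apply: leeD; apply: le_outer_measure => x [].
Qed.

Lemma Linfty_le (Omega : set 'rV[R]_n) (f : 'rV[R]_n -> R) (y : \bar R) : 0 <= y ->
  {ae @leb R n, forall x, Omega x -> (`|f x|)%:E <= y} -> Linfty Omega f <= y.
Proof.
move=> y0 fy; rewrite /Linfty unlock; case: ifP => // _.
apply: ereal_inf_lbound; apply: negligibleS fy => x /=; apply: contra_not => fxy.
by rewrite patchE; case: ifPn => [|_]; [rewrite inE => /fxy|rewrite normr0].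
Qed.

Lemma ae_eq_of_distribution (Omega : set 'rV[R]_n) (u v : 'rV[R]_n -> R) :
  (forall s : R, (0 < s)%R -> distribution_fun Omega (u \- v)%R s = 0) ->
  {ae @leb R n, forall x, Omega x -> v x = u x}.
Proof.
move=> H; apply: leb_negligible; set N := ~` _.
have NE : N `<=` \bigcup_j (Omega `&` [set x | j.+1%:R^-1 < `|(u \- v) x|]%R).
  move=> x /= /not_implyP[Ox /eqP vu].
  have uv0 : (0 < `|u x - v x|)%R by rewrite normr_gt0 subr_eq0 eq_sym.
  exists (Num.truncn (`|u x - v x|^-1)%R) => //; split => //=.
  by rewrite invf_plt ?posrE// truncnS_gt.
apply/eqP; rewrite eq_le outer_measure_ge0 andbT.
apply: le_trans (le_outer_measure _ _ _ NE) _.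
apply: le_trans (outer_measure_sigma_subadditive _ _) _.
by rewrite eseries0// => j _ _; apply: H; rewrite invr_gt0.
Qed.

End lebesgue_null_sets.

Section test_functions.
Context {R : realType} {n : nat}.
Implicit Types (phi psi : 'rV[R]_n -> R).

Lemma test_function_C1 (Omega : set 'rV[R]_n) phi : test_function Omega phi -> is_C1 phi.
Proof.
move=> [sm _ _]; split => [x|i]; first by have [] := sm [::] x I.
by split => x; [have [_] := sm [::] x I; apply|have [] := sm [:: i] x I].
Qed.

Lemma test_function_support (Omega : set 'rV[R]_n) phi : test_function Omega phi ->
  exists K, [/\ compact K, K `<=` Omega & forall x, ~ K x -> phi x = 0].
Proof.
move=> [_ cK KO]; exists (closure [set x | phi x != 0]); split => // x.
by apply: contra_notP => /eqP h; apply: subset_closure; exact: h.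
Qed.

Lemma partialB phi psi i : is_C1 phi -> is_C1 psi ->
  partial i (phi \- psi) = partial i phi \- partial i psi.
Proof.
move=> [_ /(_ i)[dphi _]] [_ /(_ i)[dpsi _]]; apply/funext => x.
by rewrite /partial deriveB.
Qed.

Lemma is_C1B phi psi : is_C1 phi -> is_C1 psi -> is_C1 (phi \- psi).
Proof.
move=> C1phi C1psi; split => [x|i].
  exact: (continuousB (C1phi.1 x) (C1psi.1 x)).
split => x.
  by apply: derivableB; [exact: (C1phi.2 i).1|exact: (C1psi.2 i).1].
by rewrite partialB//; apply: continuousB; [exact: (C1phi.2 i).2|exact: (C1psi.2 i).2].
Qed.

Lemma gradB phi psi x : is_C1 phi -> is_C1 psi ->
  grad (phi \- psi) x = grad phi x - grad psi x.
Proof. by move=> C1phi C1psi; apply/rowP => i; rewrite !mxE partialB. Qed.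

End test_functions.

Lemma uniform_cauchy_limit {R : realType} (T : Type) (f : nat -> T -> R) :
  (forall e : R, 0 < e -> exists k0, forall k l, (k0 <= k)%N -> (k0 <= l)%N ->
    forall x, `|f k x - f l x| <= e) ->
  exists v : T -> R, forall e : R, 0 < e -> exists k0, forall k, (k0 <= k)%N ->
    forall x, `|f k x - v x| <= e.
Proof.
move=> H.
have cv x : cvg (f k x @[k --> \oo]).
  apply/cauchy_cvgP/cauchy_exP => e e0.
  have [k0 k0P] := H (e / 2) ltac:(by rewrite divr_gt0).
  exists (f k0 x); exists k0 => // k /= k0k.
  by rewrite /ball/= (le_lt_trans (k0P _ _ _ _ _))//; lra.
exists (fun x => lim (f k x @[k --> \oo])) => e e0.
have [k0 k0P] := H e e0; exists k0 => k k0k x.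
have h : (f k x - f l x) @[l --> \oo] --> f k x - lim (f l x @[l --> \oo]).
  by apply: cvgB; [exact: cvg_cst|exact: cv].
apply: (cvgr_to_le (cvg_norm h)).
by exists k0 => // l /= k0l; exact: k0P.
Qed.

Theorem theorem6p4 (R : realType) (n : nat) (hn : (2 <= n)%N)
    (Omega : set 'rV[R]_n) (hOmega : open Omega)
    (u : 'rV[R]_n -> R) (Du : 'rV[R]_n -> 'rV[R]_n)
    (hu : sobolev_lorentz0 Omega u Du) :
  exists ustar : 'rV[R]_n -> R,
    [/\ {ae (@leb R n), forall x, Omega x -> ustar x = u x},
        {within closure Omega, continuous ustar},
        measurable_fun (Omega : set (Rn R n)) (ustar : Rn R n -> R) /\
          (Linfty Omega ustar < +oo)%E,
        (Linfty Omega u <=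
          (1 / (n%:R * unit_ball_volume R n `^ n%:R^-1))%:E *
          lorentz Omega (eucl \o Du))%E &
        Omega <> setT ->
          forall x, (closure Omega `\` interior Omega) x -> ustar x = 0].
Proof.
have n0 : (0 < n)%N by exact: leq_trans hn.
have [_ [phi [tphi phi_cvg]]] := hu.
set c : R := 1 / _.
have Om0 := @unit_ball_volume_gt0 R n.
have c0 : 0 < c by rewrite divr_gt0// mulr_gt0 ?ltr0n// powR_gt0.
pose L k := lorentz Omega (eucl \o (Du \- grad (phi k))).
have C1phi k : is_C1 (phi k) := test_function_C1 _ _ (tphi k).
have small (e : R) : 0 < e -> exists k0, forall k, (k0 <= k)%N ->
    (lorentz Omega (u \- phi k)%R <= e%:E)%E /\ (L k <= e%:E)%E.
  move=> e0; have : nbhs (0%E : \bar R) [set y | (y < e%:E)%E].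
    apply: open_nbhs_nbhs; split; first exact: open_ereal_lt_ereal.
    by rewrite /= lte_fin.
  move=> /phi_cvg[k0 _ k0P].
  exists k0 => k /k0P /= /ltW; rewrite /sl_norm => slk.
  have avg0 f : (0 <= lorentz_avg Omega f)%E.
    by apply: le_trans (lorentz_le_lorentz_avg Omega f); exact: lorentz_ge0.
  split; apply: le_trans slk.
    by apply: le_trans (lorentz_le_lorentz_avg _ _) _; rewrite leeDl.
  by apply: le_trans (lorentz_le_lorentz_avg _ _) _; rewrite leeDr.
have unif (e : R) : 0 < e -> exists k0, forall k l, (k0 <= k)%N -> (k0 <= l)%N ->
    forall x, `|phi k x - phi l x| <= e.
  (* Both errors [Du - grad (phi k)] and [Du - grad (phi l)] receive the weight [1/2], so the bound
     is [c * (2 L k + 2 L l)]; hence the 4. *)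
  move=> e0; have [k0 k0P] := small (e / (c * 4)) ltac:(by rewrite divr_gt0// mulr_gt0).
  exists k0 => k l /k0P[_ Lk] /k0P[_ Ll] x.
  have [K [cK KO phi0]] := test_function_support _ _ (tphi k).
  have [K' [cK' KO' phi0']] := test_function_support _ _ (tphi l).
  have := @C1_sup_bound R n hn Omega (K `|` K') (phi k \- phi l)
    (eucl \o (Du \- grad (phi k))) (eucl \o (Du \- grad (phi l))) 2^-1 x
    (is_C1B _ _ (C1phi k) (C1phi l)) (compactU cK cK').
  rewrite -lee_fin => /(_ _ _ _ _)/le_trans; apply.
  - by move=> y [/KO|/KO'].
  - by move=> y /not_orP[/phi0 + /phi0'] /=; move=> -> ->; rewrite subrr.
  - move=> z _; rewrite (gradB _ _ _ (C1phi k) (C1phi l)).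
    exact: le_trans (eucl_dist_triangle (Du z) _ _) (lerD (ler_norm _) (ler_norm _)).
  - by apply/andP; split; lra.
  have -> : (1 - 2^-1)^-1 = 2 :> R by field.
  rewrite invrK; apply: (@le_trans _ _ (c%:E * (2%:E * (e / (c * 4))%:E + 2%:E * (e / (c * 4))%:E))%E).
    apply: lee_wpmul2l; first by rewrite lee_fin ltW.
    apply: leeD; (apply: lee_wpmul2l; first by rewrite lee_fin).
      exact: Lk.
    exact: Ll.
  by rewrite lee_fin le_eqVlt; apply/orP; left; apply/eqP; field; rewrite gt_eqF.
(* The limit lives on the whole space. It is continuous there and inherits the value 0 at each point
   outside [Omega], in particular on the boundary. *)
have [v vP] := uniform_cauchy_limit _ phi unif.
have v_cont : continuous v.
  move=> x A /nbhs_ballP[e /= e0 eA]; have e3 : 0 < e / 3 by rewrite divr_gt0.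
  have [k kP] := vP (e / 3) e3.
  have nb := (C1phi k).1 x (ball (phi k x) (e / 3)) (nbhsx_ballx _ _ e3).
  apply: (@filterS _ (nbhs x) (nbhs_filter x) _ _ _ nb) => y hy; apply: eA.
  rewrite /ball/= in hy *; have h1 := kP k (leqnn k) x; have h2 := kP k (leqnn k) y.
  have -> : v x - v y = - (phi k x - v x) + (phi k x - phi k y) + (phi k y - v y) by ring.
  apply: le_lt_trans (ler_normD _ _) _; apply: le_lt_trans (lerD (ler_normD _ _) (lexx _)) _.
  by rewrite normrN; lra.
have v0 x : ~ Omega x -> v x = 0.
  move=> nOx; apply/eqP; rewrite -normr_le0; apply/ler_addgt0Pr => e e0; rewrite add0r.
  have [k kP] := vP e e0; have := kP k (leqnn k) x.
  have [K [_ KO phi0]] := test_function_support _ _ (tphi k).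
  by rewrite phi0 ?sub0r ?normrN// => /KO.
(* Where [|u - v| > s], uniform convergence forces [|u - phi k| > s / 2]. The measure of the latter
   set is controlled by [lorentz_ge_level_sum] with a single layer, a Chebyshev inequality for the
   Lorentz functional. *)
have uv : {ae @leb R n, forall x, Omega x -> v x = u x}.
  apply: ae_eq_of_distribution => s s0.
  have s20 : 0 < s / 2 by rewrite divr_gt0.
  have [k1 k1P] := vP (s / 2) s20.
  suff H : (distribution_fun Omega (u \- v)%R s `^ n%:R^-1 = 0)%E.
    by apply: (poweR_eq0_eq0 _ H); exact: distribution_fun_ge0.
  apply/eqP; rewrite eq_le poweR_ge0 andbT; apply/lee_addgt0Pr => e e0; rewrite add0e.
  have [k2 k2P] := small (n%:R * (s / 2) * e) ltac:(by rewrite !mulr_gt0// ltr0n).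
  pose k := maxn k1 k2.
  apply: (@le_trans _ _ (distribution_fun Omega (u \- phi k)%R (s / 2) `^ n%:R^-1)%E).
    rewrite gt0_ler_poweR ?invr_ge0// ?in_itv/= ?andbT ?leey ?distribution_fun_ge0//.
    apply: le_outer_measure => x [Ox /= sx]; split => //=.
    have := k1P k (leq_maxl _ _) x; have := ler_distD (phi k x) (u x) (v x); lra.
  have [h _] := k2P k (leq_maxr _ _).
  have := le_trans (lorentz_ge_level_sum n0 Omega (u \- phi k)%R (s / 2) 1 (ltW s20)) h.
  rewrite big_ord1 mul1r muleA -EFinM [X in (_ <= X)%E]EFinM lee_pmul2l//.
  by rewrite lte_fin mulr_gt0// ltr0n.
have v_le x : ((`|v x|)%:E <= c%:E * lorentz Omega (eucl \o Du))%E.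
  have := lorentz_ge0 Omega (eucl \o Du).
  case LE : (lorentz Omega (eucl \o Du)) => [l||]// l0; last by rewrite gt0_muley ?lte_fin ?leey.
  (* The approximation error [d] is divided by [e], so [d] tends to 0 for fixed [e], and [e]
     afterwards. The goal for fixed [e] is [(1 - e) |v x| <= c l], which accounts for the constant
     [|v x|]; the constant for [d] is [c / e + 1], from the gradient error and the uniform distance
     of [phi k] to [v]. *)
  rewrite -EFinM lee_fin; apply: (@le_eps _ _ _ `|v x|) => // e /andP[e0 e1].
  have e1' : 0 < 1 - e by lra.
  rewrite -lerBlDr -[X in X - _]mulr1 -mulrBr -ler_pdivlMr//.
  apply: (@le_eps _ _ _ (c * e^-1 + 1)) => [|d /andP[d0 d1]].
    by rewrite addr_ge0// mulr_ge0 ?invr_ge0 ?(ltW c0) ?(ltW e0).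
  have [k1 k1P] := vP d d0; have [k2 k2P] := small d d0.
  pose k := maxn k1 k2; have [_ Lk] := k2P k (leq_maxr _ _).
  have [K [cK KO phi0]] := test_function_support _ _ (tphi k).
  have tri z : Omega z -> eucl (grad (phi k) z) <=
      `|(eucl \o Du) z| + `|(eucl \o (Du \- grad (phi k))) z|.
    move=> _; have := eucl_dist_triangle (Du z) 0 (grad (phi k) z).
    rewrite sub0r euclN subr0 => /le_trans; apply.
    exact: lerD (ler_norm _) (ler_norm _).
  have H : `|phi k x| <= c * ((1 - e)^-1 * l + e^-1 * d).
    rewrite -lee_fin; apply: (le_trans (C1_sup_bound hn _ _ _ _ _ e x (C1phi k) cK KO phi0 tri _)).
      by rewrite e0.
    rewrite LE [leRHS]EFinM; apply: lee_wpmul2l; first by rewrite lee_fin ltW.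
    rewrite EFinD; apply: leeD; first by rewrite EFinM.
    by rewrite [leRHS]EFinM; apply: lee_wpmul2l; [rewrite lee_fin invr_ge0 ltW|exact: Lk].
  have h := k1P k (leq_maxl _ _) x.
  have -> : v x = phi k x - (phi k x - v x) by ring.
  apply: le_trans (ler_normB _ _) _; apply: le_trans (lerD H h) _.
  by rewrite le_eqVlt; apply/orP; left; apply/eqP; rewrite mulrDr mulrDl; ring.
exists v; split => //.
- exact: continuous_subspaceT.
- split; first by apply: continuous_measurable_Rn => // x _; exact: v_cont.
  (* A bounded test function lies within distance 1 of [v], which gives finiteness. *)
  have [k kP] := vP 1 ltr01.
  have [K [cK _ phi0]] := test_function_support _ _ (tphi k).
  have [M phiM] := compact_support_bounded _ _ cK (C1phi k).1 phi0.
  apply: (@le_lt_trans _ _ (`|M| + 1)%:E); last exact: ltry.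
  apply: Linfty_le; first by rewrite lee_fin addr_ge0.
  apply: aeW => x _; rewrite lee_fin.
  have -> : v x = phi k x - (phi k x - v x) by ring.
  apply: le_trans (ler_normB _ _) _; apply: lerD; last exact: kP.
  exact: le_trans (phiM x) (ler_norm _).
- apply: Linfty_le; first by rewrite mule_ge0 ?lorentz_ge0// lee_fin ltW.
  by apply: negligibleS uv => x /=; apply: contra_not => uvx Ox; rewrite -uvx.
- by move=> _ x [_]; rewrite ((interior_id Omega).1 hOmega) => /v0.
Qed.
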